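(* Let $T$ be a countable complete first-order theory with monster model $\mathfrak{C}$, let $A\subseteq\mathfrak{C}$ be countable and let $\alpha$ be a countable ordinal. Suppose that: (1) $X\subseteq\mathfrak{C}^\alpha$ is type definable over $A$. (2) $E$ is a pseudo $F_\sigma$, $\emptyset$-invariant equivalence relation on $X$ with normal form $\langle U_n\mid n<\omega\rangle$, and $E$ is bounded on $X$. (3) $C\subseteq X$ is an $E$-class, and $E\upharpoonright C$ is not strongly closed with respect to $\langle U_n\mid n<\omega\rangle$, i.e. there is no $n<\omega$ with $E\cap C^2=U_n\cap C^2$. (4) $C\subseteq Y\subseteq X$, where $Y$ is pseudo $G_\delta$ and $E$-invariant (a union of $E$-classes). (5) $\Gamma\leq\operatorname{Aut}(\mathfrak{C})$ is $C$-transitive (for all $a,b\in C$ there is $\sigma\in\Gamma$ with $\sigma(a)=b$) and preserves all $E$-classes (in particular, it preserves $X$). Then $E\upharpoonright Y$ is not smooth.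
   Context: $\mathfrak{C}$ is a monster model of $T$: $\kappa$-saturated and $\kappa$-homogeneous for a big cardinal $\kappa$. ''Small'' means of cardinality $<\kappa$; all parameter sets and models ($M\prec\mathfrak{C}$) are small. A subset of $\mathfrak{C}^\alpha$ is pseudo closed if it is type definable over some small set, pseudo open if its complement is pseudo closed, and pseudo $G_\delta$ (pseudo $F_\sigma$) if it is a countable intersection of pseudo open (countable union of pseudo closed) sets. A set is $\emptyset$-invariant if it is invariant under $\operatorname{Aut}(\mathfrak{C})$. An $\emptyset$-invariant pseudo $F_\sigma$ equivalence relation on $X$ means an $\emptyset$-invariant pseudo $F_\sigma$ set $E\subseteq\mathfrak{C}^\alpha\times\mathfrak{C}^\alpha$ whose restriction to $X$ is an equivalence relation; it is bounded if $|X/E|<\kappa$. A normal form is a sequence of $\emptyset$-type definable sets $U_n\subseteq\mathfrak{C}^\alpha\times\mathfrak{C}^\alpha$ with $E=\bigcup_{n<\omega}U_n$, such that $U_0$ contains the diagonal of $X$, each $U_n$ is symmetric, and for all $a,b,c\in X$, $(a,c),(c,b)\in U_n$ implies $(a,b)\in U_{n+1}$. For a model $M\supseteq A$ and $Z\subseteq\mathfrak{C}^\alpha$, $Z_M=\{\operatorname{tp}(a/M)\mid a\in Z\}\subseteq S_\alpha(M)$, with the topology induced from the Stone space. For $p,q\in X_M$, $p\mathrel{E^M}q$ iff there are $a\models p$, $b\models q$ in $\mathfrak{C}$ with $a\mathrel{E}b$ (equivalently, all such $a,b$ satisfy $a\mathrel{E}b$). When $M\supseteq A$ is a countable model, $S_\alpha(M)$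 is Polish, $Y_M$ is a $G_\delta$ subset of it, and $E^M\upharpoonright Y_M$ is an $F_\sigma$ equivalence relation whose Borel cardinality (class up to Borel bi-reducibility) does not depend on the choice of the countable model $M\supseteq A$. ''$E\upharpoonright Y$ is smooth'' means that $E^M\upharpoonright Y_M$ is smooth for some (equivalently every) countable model $M\supseteq A$, i.e. there is a Borel map $f:Y_M\to2^\omega$ with $p\mathrel{E^M}q\iff f(p)=f(q)$. *)

(* Defs.v *)
From HB Require Import structures.
From mathcomp Require Import all_boot all_order all_algebra.
From mathcomp Require Import all_classical all_reals all_analysis.

Set Implicit Arguments.
Unset Strict Implicit.
Unset Printing Implicit Defensive.

Local Open Scope classical_set_scope.
Local Open Scope card_scope.

(** * First-order logic *)

Record language := Language {
  fsym : Type;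
  farity : fsym -> nat;
  rsym : Type;
  rarity : rsym -> nat
}.

Definition countable_language (L : language) : Prop :=
  countable [set: fsym L] /\ countable [set: rsym L].

(* Terms and formulas have their free variables in an arbitrary type [V].
   A quantifier binds the variable [None] of a formula over [option V].
   Parameters are treated as further free variables: an L(B)-formula in the
   variables (x_i | i in I) is a formula over [I + B]. *)
Inductive term (L : language) (V : Type) : Type :=
| TVar : V -> term L V
| TApp : forall f : fsym L, ('I_(farity f) -> term L V) -> term L V.

Inductive formula (L : language) (V : Type) : Type :=
| FEq : term L V -> term L V -> formula L V
| FRel : forall r : rsym L, ('I_(rarity r) -> term L V) -> formula L V
| FFalse : formula L V
| FImp : formula L V -> formula L V -> formula L V
| FAll : formula L (option V) -> formula L V.

Definition FNot (L : language) (V : Type) (phi : formula L V) : formula L V :=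
  FImp phi (FFalse L V).

Record structure (L : language) := Structure {
  carrier :> Type;
  carrier_inhabited : inhabited carrier;
  finterp : forall f : fsym L, ('I_(farity f) -> carrier) -> carrier;
  rinterp : forall r : rsym L, ('I_(rarity r) -> carrier) -> Prop
}.

Fixpoint term_eval (L : language) (N : structure L) (V : Type) (v : V -> N)
    (t : term L V) : N :=
  match t with
  | TVar x => v x
  | TApp f s => finterp (fun i => term_eval v (s i))
  end.

Fixpoint sat (L : language) (N : structure L) (V : Type) (phi : formula L V) :
    (V -> N) -> Prop :=
  match phi with
  | FEq s t => fun v => term_eval v s = term_eval v t
  | FRel r s => fun v => rinterp (fun i => term_eval v (s i))
  | FFalse => fun _ => False
  | FImp phi1 phi2 => fun v => sat phi1 v -> sat phi2 v
  | FAll phi1 => fun v =>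
      forall x : N, sat phi1 (fun w => if w is Some y then v y else x)
  end.

Definition theory (L : language) : Type := set (formula L void).

Definition models (L : language) (N : structure L) (T : theory L) : Prop :=
  forall phi, T phi -> sat phi (of_void N).

Definition entails (L : language) (T : theory L) (phi : formula L void) : Prop :=
  forall N : structure L, models N T -> sat phi (of_void N).

Definition complete_theory (L : language) (T : theory L) : Prop :=
  (exists N : structure L, models N T) /\
  forall phi, entails T phi \/ entails T (FNot phi).

Definition automorphism (L : language) (N : structure L) (s : N -> N) : Prop :=
  [/\ bijective s,
      forall (f : fsym L) (x : 'I_(farity f) -> N),
        s (finterp x) = finterp (s \o x) &
      forall (r : rsym L) (x : 'I_(rarity r) -> N),
        rinterp x <-> rinterp (s \o x)].

Definition automorphism_subgroup (L : language) (N : structure L)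
    (G : set (N -> N)) : Prop :=
  [/\ forall s, G s -> automorphism s,
      G id,
      forall s t, G s -> G t -> G (s \o t) &
      forall s, G s -> exists t, [/\ G t, cancel s t & cancel t s]].

Definition fun_closed (L : language) (N : structure L) (M : set N) : Prop :=
  forall (f : fsym L) (x : 'I_(farity f) -> N),
    (forall i, M (x i)) -> M (finterp x).

Lemma inhabited_set_type (T : Type) (M : set T) : M !=set0 -> inhabited M.
Proof. by case=> x Mx; constructor; exists x; exact: mem_set. Qed.

Lemma fun_closed_val (L : language) (N : structure L) (M : set N)
    (Mf : fun_closed M) (f : fsym L) (x : 'I_(farity f) -> M) :
  finterp (fun i => val (x i)) \in M.
Proof. by apply/mem_set/Mf => i; apply: set_mem; exact: valP. Qed.

Definition substructure (L : language) (N : structure L) (M : set N)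
    (M0 : M !=set0) (Mf : fun_closed M) : structure L :=
  @Structure L M (inhabited_set_type M0)
    (fun f x => exist _ (finterp (fun i => val (x i))) (fun_closed_val Mf x))
    (fun r x => rinterp (fun i => val (x i))).

Definition elementary_substructure (L : language) (N : structure L)
    (M : set N) : Prop :=
  exists (M0 : M !=set0) (Mf : fun_closed M),
    forall (V : Type) (phi : formula L V) (v : V -> substructure M0 Mf),
      sat phi v <-> @sat L N V phi (fun x => val (v x)).

(** * Types and the Stone space *)

Definition with_params (L : language) (N : structure L) (I : Type) (B : set N)
    (a : I -> N) (w : I + B) : N :=
  match w with inl i => a i | inr b => val b end.

Definition finitely_satisfiable (L : language) (N : structure L) (I : Type)
    (B : set N) (p : set (formula L (I + B))) : Prop :=
  forall F : set (formula L (I + B)), finite_set F -> F `<=` p ->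
    exists a : I -> N, forall phi, F phi -> sat phi (with_params a).

(* [stone_space I B] is S_I(B), computed in the ambient structure [N]. *)
Record stone_space (L : language) (N : structure L) (I : Type) (B : set N) :=
  StoneType {
    type_formulas :> set (formula L (I + B));
    type_finsat : finitely_satisfiable type_formulas;
    type_complete : forall phi, type_formulas phi \/ type_formulas (FNot phi)
  }.
Arguments stone_space {L N} I B.

HB.instance Definition _ (L : language) (N : structure L) (I : Type)
  (B : set N) := gen_eqMixin (@stone_space L N I B).
HB.instance Definition _ (L : language) (N : structure L) (I : Type)
  (B : set N) := gen_choiceMixin (@stone_space L N I B).

Definition basic_clopen (L : language) (N : structure L) (I : Type)
    (B : set N) (phi : formula L (I + B)) : set (@stone_space L N I B) :=
  [set p : stone_space I B | type_formulas p phi].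

HB.instance Definition _ (L : language) (N : structure L) (I : Type)
  (B : set N) :=
  @isSubBaseTopological.Build (@stone_space L N I B)
    (set (@stone_space L N I B)) (range (@basic_clopen L N I B)) id.

Section TypeOf.
Variables (L : language) (N : structure L) (I : Type) (B : set N) (a : I -> N).

Let tp_formulas : set (formula L (I + B)) :=
  [set phi | sat phi (with_params a)].

Let tp_finsat : finitely_satisfiable tp_formulas.
Proof. by move=> F _ Fa; exists a => phi /Fa. Qed.

Let tp_complete phi : tp_formulas phi \/ tp_formulas (FNot phi).
Proof. exact: EM. Qed.

Definition tp : stone_space I B := StoneType tp_finsat tp_complete.

End TypeOf.
Arguments tp {L N I} B a.

(** * Monster models *)

(* The cardinal kappa is given as (the cardinality of) a type [K]. *)
Definition small (K T : Type) (Z : set T) : Prop :=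
  Z #<= [set: K] /\ ~ ([set: K] #<= Z).

Definition saturated (K : Type) (L : language) (N : structure L) : Prop :=
  forall B : set N, small K B ->
    forall p : stone_space unit B, exists a : unit -> N, tp B a = p.

(* Homogeneity in the strong sense: elementary maps between small sets extend
   to automorphisms. *)
Definition homogeneous (K : Type) (L : language) (N : structure L) : Prop :=
  forall (B : set N) (f : B -> N), small K B ->
    (forall phi : formula L B,
       @sat L N B phi (fun b => val b) <-> sat phi f) ->
    exists2 s : N -> N, automorphism s & forall b : B, s (val b) = f b.

(* Any uncountable kappa is admitted as a "big" cardinal; since the language
   will be countable, this says kappa > |T|. *)
Definition monster (K : Type) (L : language) (N : structure L) : Prop :=
  [/\ ~ countable [set: K], saturated K N & homogeneous K N].

Definition type_definable (L : language) (N : structure L) (I : Type)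
    (B : set N) (Z : set (I -> N)) : Prop :=
  exists S : set (formula L (I + B)),
    Z = [set a | forall phi, S phi -> sat phi (with_params a)].

Definition pseudo_closed (K : Type) (L : language) (N : structure L) (I : Type)
    (Z : set (I -> N)) : Prop :=
  exists2 B : set N, small K B & type_definable B Z.

Definition pseudo_open (K : Type) (L : language) (N : structure L) (I : Type)
    (Z : set (I -> N)) : Prop := pseudo_closed K (~` Z).

Definition pseudo_Gdelta (K : Type) (L : language) (N : structure L) (I : Type)
    (Z : set (I -> N)) : Prop :=
  exists2 O : nat -> set (I -> N),
    forall n, pseudo_open K (O n) & Z = \bigcap_n O n.

Definition pseudo_Fsigma (K : Type) (L : language) (N : structure L) (I : Type)
    (Z : set (I -> N)) : Prop :=
  exists2 F : nat -> set (I -> N),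
    forall n, pseudo_closed K (F n) & Z = \bigcup_n F n.

Definition aut_invariant (L : language) (N : structure L) (I : Type)
    (Z : set (I -> N)) : Prop :=
  forall s : N -> N, automorphism s -> (fun a => s \o a) @` Z = Z.

(** * Equivalence relations on sets of tuples *)

(* Identifies a set of pairs of I-tuples with a set of (I + I)-tuples. *)
Definition flatten_rel (N I : Type) (E : set ((I -> N) * (I -> N))) :
    set (I + I -> N) :=
  [set c : I + I -> N | E (c \o inl, c \o inr)].

Definition equivalence_on (T : Type) (X : set T) (E : set (T * T)) : Prop :=
  [/\ forall a, X a -> E (a, a),
      forall a b, X a -> X b -> E (a, b) -> E (b, a) &
      forall a b c, X a -> X b -> X c -> E (a, b) -> E (b, c) -> E (a, c)].

Definition is_class (T : Type) (X : set T) (E : set (T * T)) (C : set T) :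
    Prop :=
  exists2 a, X a & C = [set b | X b /\ E (a, b)].

Definition bounded_on (K T : Type) (X : set T) (E : set (T * T)) : Prop :=
  small K [set C | is_class X E C].

Definition invariant_Fsigma_equivalence (K : Type) (L : language)
    (N : structure L) (I : Type) (X : set (I -> N))
    (E : set ((I -> N) * (I -> N))) : Prop :=
  [/\ aut_invariant (flatten_rel E), pseudo_Fsigma K (flatten_rel E) &
      equivalence_on X E].

Definition normal_form (L : language) (N : structure L) (I : Type)
    (X : set (I -> N)) (E : set ((I -> N) * (I -> N)))
    (U : nat -> set ((I -> N) * (I -> N))) : Prop :=
  [/\ forall n, type_definable set0 (flatten_rel (U n)),
      E = \bigcup_n U n,
      forall a, X a -> U 0%N (a, a),
      forall n a b, U n (a, b) -> U n (b, a) &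
      forall n a b c, X a -> X b -> X c ->
        U n (a, c) -> U n (c, b) -> U n.+1 (a, b)].

Definition strongly_closed (T : Type) (C : set T) (E : set (T * T))
    (U : nat -> set (T * T)) : Prop :=
  exists n : nat, E `&` (C `*` C) = U n `&` (C `*` C).

Definition class_saturated (T : Type) (X : set T) (E : set (T * T))
    (Y : set T) : Prop :=
  exists2 D : set (set T), D `<=` is_class X E & Y = \bigcup_(C in D) C.

Definition transitive_on (N I : Type) (C : set (I -> N)) (G : set (N -> N)) :
    Prop :=
  forall a b, C a -> C b -> exists2 s, G s & s \o a = b.

Definition preserves_classes (N I : Type) (X : set (I -> N))
    (E : set ((I -> N) * (I -> N))) (G : set (N -> N)) : Prop :=
  forall s C, G s -> is_class X E C -> (fun a => s \o a) @` C = C.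

(** * Smoothness *)

Definition types_of (L : language) (N : structure L) (I : Type)
    (M : set N) (Z : set (I -> N)) : set (stone_space I M) := tp M @` Z.
Arguments types_of {L N I} M Z.

Definition type_rel (L : language) (N : structure L) (I : Type)
    (M : set N) (E : set ((I -> N) * (I -> N))) (p q : stone_space I M) :
    Prop :=
  exists a b : I -> N, [/\ tp M a = p, tp M b = q & E (a, b)].

(* Borel measurability on the subspace [D], whose open sets are the traces of
   the open sets.  ([measurable_fun D f] would hold trivially if [D] were not
   itself known to be Borel.) *)
Definition borel_on (S T : topologicalType) (D : set S) (f : S -> T) : Prop :=
  forall B : set T, <<s [set O : set T | open O] >> B ->
    <<s D, [set D `&` O | O in [set O : set S | open O]] >> (D `&` f @^-1` B).

Definition smooth_on_types (S : topologicalType) (D : set S)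
    (R : S -> S -> Prop) : Prop :=
  exists2 f : S -> cantor_space, borel_on D f &
    forall p q, D p -> D q -> (R p q <-> f p = f q).

Definition smooth (L : language) (N : structure L) (A : set N) (I : Type)
    (E : set ((I -> N) * (I -> N))) (Y : set (I -> N)) : Prop :=
  exists M : set N,
    [/\ elementary_substructure M, countable M, A `<=` M &
        smooth_on_types (types_of M Y) (@type_rel L N I M E)].

(* Main.v *)
Require Import Defs.
From mathcomp Require Import all_boot all_order all_algebra.
From mathcomp Require Import all_classical all_reals all_analysis.

(** Let F be a maximal Gamma-invariant proper filter of sets of tuples
    containing C (dually, a minimal subflow of the closure of C), and call a
    definable set positive if its complement is not in F. By maximality Gamma
    acts transitively on positive sets.

    Call a formula theta thick if, for every ultrafilter V on C, theta (x, y)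
    holds for V-almost all x and V-almost all y. The sets theta (c, -) with c
    in C are positive, and since E is bounded, the points lying in all of them
    are E-equivalent to c. Compactness then shows that generic points, those
    obtained from generic descending sequences of positive sets, lie in Y.

    A Borel reduction to equality on the Cantor space pulls back to sets with
    the Baire property, invariant under Gamma, so by the zero-one law all
    generic points lie in a single class, that of a0 say. By Baire category
    some U_n (a0, -) is not negligible in some positive set D. Finitely many
    translates of D cover an element of F, so every neighbourhood of some U_m
    (a0, -) belongs to F. This set therefore meets every thick neighbourhood of
    a point of C, whence a0 is in C, and it meets its translate by every
    element of Gamma, which bounds the U-diameter of C. *)

Set Implicit Arguments.
Unset Strict Implicit.
Unset Printing Implicit Defensive.

Local Open Scope classical_set_scope.
Local Open Scope card_scope.

(** * Formulas *)

Section Syntax.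
Variable L : language.
Implicit Types N : structure L.

Fixpoint tren (V W : Type) (r : V -> W) (t : term L V) : term L W :=
  match t with
  | TVar x => TVar L (r x)
  | TApp f s => TApp (fun i => tren r (s i))
  end.

Fixpoint fren (V W : Type) (r : V -> W) (phi : formula L V) : formula L W :=
  match phi with
  | FEq s t => FEq (tren r s) (tren r t)
  | FRel R s => FRel (fun i => tren r (s i))
  | FFalse => FFalse L W
  | FImp phi psi => FImp (fren r phi) (fren r psi)
  | FAll phi => FAll (fren (omap r) phi)
  end.

Lemma term_eval_tren N V W (r : V -> W) (t : term L V) (v : W -> N) :
  term_eval v (tren r t) = term_eval (v \o r) t.
Proof. by elim: t => //= f s IH; congr finterp; apply/funext => i. Qed.

Lemma sat_fren N V W (r : V -> W) (phi : formula L V) (v : W -> N) :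
  sat (fren r phi) v <-> sat phi (v \o r).
Proof.
elim: phi W r v => {V} [V s t|V R s|V|V phi IH1 psi IH2|V phi IH] W r v //=.
- by rewrite !term_eval_tren.
- suff -> : (fun i => term_eval v (tren r (s i))) =
    (fun i => term_eval (v \o r) (s i)) by [].
  by apply/funext => i; rewrite term_eval_tren.
- by rewrite IH1 IH2.
- have E x : (fun w => if w is Some y then v y else x) \o omap r =
      (fun w : option V => if w is Some y then (v \o r) y else x).
    by apply/funext => -[].
  by split=> H x; have := H x; rewrite IH E.
Qed.

Lemma sat_aut N (s : N -> N) V (phi : formula L V) (v : V -> N) :
  automorphism s -> sat phi (s \o v) <-> sat phi v.
Proof.
case=> bs sf sr.
have tE (U : Type) (t : term L U) (w : U -> N) :
    term_eval (s \o w) t = s (term_eval w t).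
  elim: t => //= f x IH; rewrite sf; congr finterp.
  by apply/funext => i /=.
elim: phi v => {V} [V x y|V R x|V|V phi IH1 psi IH2|V phi IH] v //=.
- by rewrite !tE; split=> [/(bij_inj bs)|->].
- rewrite [X in _ <-> X]sr /comp.
  suff -> : (fun i => term_eval (fun w => s (v w)) (x i)) =
    (fun i => s (term_eval v (x i))) by [].
  by apply/funext => i; rewrite -tE.
- by rewrite IH1 IH2.
- have E x : s \o (fun w => if w is Some y then v y else x) =
      (fun w : option V => if w is Some y then (s \o v) y else s x).
    by apply/funext => -[].
  split=> H x; first by rewrite -IH E.
  by have [t _ tK] := bs; rewrite -(tK x) -E IH.
Qed.

Definition FAnd V (phi psi : formula L V) := FNot (FImp phi (FNot psi)).
Definition FEx V (phi : formula L (option V)) := FNot (FAll (FNot phi)).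

Lemma sat_FAnd N V (phi psi : formula L V) (v : V -> N) :
  sat (FAnd phi psi) v <-> sat phi v /\ sat psi v.
Proof.
split=> /= [H|[H1 H2]]; last by move/(_ H1 H2).
by split; apply: contrapT => nH; apply: H => // H' H''.
Qed.

Lemma sat_FEx N V (phi : formula L (option V)) (v : V -> N) :
  sat (FEx phi) v <->
  exists x, sat phi (fun w => if w is Some y then v y else x).
Proof.
split=> /= [H|[x Hx] H]; last exact: (H x).
by apply: contrapT => nH; apply: H => x Hx; apply: nH; exists x.
Qed.

(* A formula only depends on finitely many variables; the function [e] lets
   us express this without listing them. *)
Lemma sat_depends_below N V (e : V -> nat) (phi : formula L V) :
  exists n, forall v w : V -> N,
    (forall x, (e x < n)%N -> v x = w x) -> sat phi v <-> sat phi w.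
Proof.
have tE (U : Type) (d : U -> nat) (t : term L U) :
  exists n, forall v w : U -> N,
    (forall x, (d x < n)%N -> v x = w x) -> term_eval v t = term_eval w t.
  elim: t => [x|f x /choice[n nP]].
    by exists (d x).+1 => v w vw; exact: vw.
  exists (\max_i n i)%N => v w vw /=; congr finterp; apply/funext => i.
  apply: nP => y yn; apply: vw; apply: leq_trans yn _.
  exact: leq_bigmax.
elim: phi e => {V} [V s t|V R s|V|V phi IH1 psi IH2|V phi IH] e /=.
- have [n nP] := tE V e s; have [m mP] := tE V e t.
  exists (maxn n m) => v w vw; rewrite (nP v w) ?(mP v w)// => x xm; apply: vw;
    by apply: leq_trans xm _; rewrite ?leq_maxl ?leq_maxr.
- have /choice[n nP] := fun i => tE V e (s i).
  exists (\max_i n i)%N => v w vw.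
  suff -> : (fun i => term_eval v (s i)) = (fun i => term_eval w (s i)) by [].
  apply/funext => i; apply: nP => y yn; apply: vw; apply: leq_trans yn _.
  exact: leq_bigmax.
- by exists 0%N.
- have [n nP] := IH1 e; have [m mP] := IH2 e.
  exists (maxn n m) => v w vw; rewrite (nP v w) ?(mP v w)// => x xm; apply: vw;
    by apply: leq_trans xm _; rewrite ?leq_maxl ?leq_maxr.
- have [n nP] := IH (fun w => if w is Some y then e y else 0%N).
  exists n => v w vw; split=> H x; have := H x; apply nP => -[y|] //= yn;
  [exact: esym (vw _ yn)|exact: vw].
Qed.

(** By induction on [n], at most one variable is bound at each step: injectivity of [e] on [P]
    leaves at most one variable of [P] with code [n], and this one is renamed to [None] under a new
    quantifier. *)
Lemma exists_closure V (e : V -> nat) (P : set V) n (phi : formula L V) :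
  {in P &, injective e} ->
  exists psi : formula L V, forall N (v : V -> N), sat psi v <->
    exists2 w : V -> N, forall x, ~ (P x /\ (e x < n)%N) -> w x = v x
                      & sat phi w.
Proof.
move=> einj; elim: n => [|n [psi psiE]].
  exists phi => N v; split=> [|[w wv]]; first by exists v.
  by have -> : w = v by apply/funext => x; apply: wv => -[].
have [[x [Px xn]]|nex] := pselect (exists x, P x /\ e x = n); last first.
  exists psi => N v; rewrite psiE; split=> -[w wv phiw]; exists w => // y;
    move=> yn; apply: wv => -[Py] ylt; apply: yn; split => //.
    by rewrite ltnS ltnW.
  rewrite ltn_neqAle -ltnS ylt andbT; apply/eqP => /eqP yn.
  by apply: nex; exists y; split => //; apply/eqP.
exists (FEx (fren (fun y => if pselect (y = x) then None else Some y) psi)).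
move=> N v; rewrite sat_FEx; split.
- case=> a; rewrite sat_fren psiE => -[w wE phiw].
  exists w => // y yn; rewrite wE /=; last first.
    by move=> [Py ylt]; apply: yn; split => //; rewrite ltnS ltnW.
  by case: pselect => // yx; case: yn; rewrite yx; split=> //; rewrite xn.
- case=> w wv phiw; exists (w x); rewrite sat_fren psiE; exists w => // y yn /=.
  case: pselect => [yx|yx] /=; first by rewrite yx.
  apply: wv => -[Py]; rewrite ltnS leq_eqVlt.
  case/orP=> [/eqP yen|ylt]; last exact: yn.
  by apply: yx; apply: einj; rewrite ?inE// xn.
Qed.

(** * Countability of the set of formulas, by coding into finite trees *)

Fixpoint term_code V (c : V -> nat) (cf : Defs.fsym L -> nat) (t : term L V) :
    GenTree.tree nat :=
  match t with
  | TVar x => GenTree.Leaf (c x)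
  | TApp f s =>
      GenTree.Node (cf f) [seq term_code c cf (s i) | i <- enum 'I_(farity f)]
  end.

(** The bound variable gets code 0 and the others move up by one, so codes stay injective under
    quantifiers. *)
Definition option_code V (c : V -> nat) (x : option V) : nat :=
  if x is Some y then (c y).+1 else 0%N.

Fixpoint formula_code V (c : V -> nat) (cf : Defs.fsym L -> nat)
    (cr : rsym L -> nat) (phi : formula L V) : GenTree.tree nat :=
  match phi with
  | FEq s t => GenTree.Node 0 [:: term_code c cf s; term_code c cf t]
  | FRel R s => GenTree.Node 1 (GenTree.Leaf (cr R) ::
      [seq term_code c cf (s i) | i <- enum 'I_(rarity R)])
  | FFalse => GenTree.Node 2 [::]
  | FImp phi psi =>
      GenTree.Node 3 [:: formula_code c cf cr phi; formula_code c cf cr psi]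
  | FAll phi => GenTree.Node 4 [:: formula_code (option_code c) cf cr phi]
  end.

Lemma map_enum_inj n (T : Type) (x y : 'I_n -> T) :
  [seq x i | i <- enum 'I_n] = [seq y i | i <- enum 'I_n] -> x = y.
Proof.
move=> xy; apply/funext => i.
have sz : (i < size (enum 'I_n))%N by rewrite size_enum_ord.
have := congr1 (fun s => nth (x i) s i) xy.
by rewrite (nth_map i) // [RHS](nth_map i) // nth_ord_enum.
Qed.

Lemma term_code_inj V (c : V -> nat) (cf : Defs.fsym L -> nat) :
  injective c -> injective cf -> injective (term_code c cf).
Proof.
move=> cI cfI; elim=> [x|f s IH] [y|g t] //= [].
- by move/cI => ->.
- move/cfI => fg; case: g / fg t => t /map_enum_inj st; congr TApp.
  by apply/funext => i; apply: IH; have := congr1 (fun h => h i) st.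
Qed.

Lemma formula_code_inj V (c : V -> nat) (cf : Defs.fsym L -> nat)
    (cr : rsym L -> nat) : injective c -> injective cf -> injective cr ->
  injective (formula_code c cf cr).
Proof.
move=> cI cfI crI phi.
elim: phi c cI => {V} [V s t|V R s|V|V phi IH1 psi IH2|V phi IH] c cI
  [s' t'|R' s'||phi' psi'|phi'] //= [].
- by move=> /(term_code_inj cI cfI)-> /(term_code_inj cI cfI)->.
- move/crI => RR; case: R' / RR s' => s' /map_enum_inj ss; congr FRel.
  apply/funext => i; apply: (term_code_inj cI cfI).
  by have := congr1 (fun h => h i) ss.
- by move=> /IH1-/(_ cI)-> /IH2-/(_ cI)->.
- move=> /IH -> //; case=> [x|] [y|] //= [].
  by move/cI => ->.
Qed.

Lemma countable_formula V : countable_language L -> countable [set: V] ->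
  countable [set: formula L V].
Proof.
case=> /countable_injP[cf cfI] /countable_injP[cr crI] /countable_injP[c cI].
have inj (T : Type) (f : T -> nat) :
    {in [set: T] &, injective f} -> injective f.
  by move=> fI x y; apply: fI; rewrite inE.
apply/countable_injP; exists (pickle \o formula_code c cf cr) => x y _ _.
move/(pcan_inj pickleK); apply: formula_code_inj; exact: inj.
Qed.

End Syntax.
Arguments FAnd : simpl never.
Arguments FEx : simpl never.

(** * Small sets *)

Section Cardinality.

Lemma countable_range (I T : Type) (a : I -> T) :
  countable [set: I] -> countable (range a).
Proof. exact: card_le_trans (card_image_le _ _). Qed.

Lemma card_le_injE (T U : Type) (u0 : U) (A : set T) (B : set U) :
  A #<= B <-> exists f : T -> U, (forall x, A x -> B (f x)) /\
                (forall x y, A x -> A y -> f x = f y -> x = y).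
Proof.
split.
  elim/Ppointed: U => U in u0 B *; first by case: (no u0).
  move=> /pcard_leP[f]; exists f; split.
    by move=> x Ax; exact: funS.
  by move=> x y Ax Ay; apply: inj; rewrite inE.
case=> f [fS fI]; have : f @` A #= A.
  by apply: inj_card_eq => x y; rewrite !inE; exact: fI.
move/card_eqPle => -[_ h]; apply: card_le_trans h _.
by apply: subset_card_le => _ [x Ax <-]; exact: fS.
Qed.

Lemma countable_setU (T : Type) (A B : set T) :
  countable A -> countable B -> countable (A `|` B).
Proof.
move=> cA cB; rewrite -bigcup2E; apply: bigcup_countable => [//|[|[|n]] _ //=].
Qed.

(** [Z] embeds at level 0, and the other points of [D] go into the fibre over [z0] at levels at
    least 1, so the two images are disjoint. *)
Lemma setU_countable_le_setX (T : Type) (Z D : set T) (z0 : T) :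
  Z z0 -> countable D -> Z `|` D #<= Z `*` [set: nat].
Proof.
move=> Zz0 /countable_injP[c cI]; apply/(card_le_injE (z0, 0%N)).
exists (fun x => if pselect (Z x) then (x, 0%N) else (z0, (c x).+1)); split.
  by move=> x _; case: pselect.
move=> x y [Zx|Dx] [Zy|Dy]; do 2 case: pselect => //=; try by move=> _ _ [].
by move=> _ _ [] /cI; apply; rewrite inE.
Qed.

(* Zorn's lemma is applied to the graphs [R] of injections [A * nat -> A]. *)
Lemma infinite_setX_nat (T : Type) (Z : set T) :
  infinite_set Z -> Z `*` [set: nat] #<= Z.
Proof.
move=> Zinf; have [z0 Zz0] := infinite_setN0 Zinf.
(* The last two clauses say that the values of [R] lie in the set of its first coordinates, and that
   [R] is defined on the whole product of this set with [nat]. *)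
pose good (R : set ((T * nat) * T)) :=
  [/\ forall x n y, R ((x, n), y) -> Z x,
      forall p y y', R (p, y) -> R (p, y') -> y = y',
      forall p p' y, R (p, y) -> R (p', y) -> p = p',
      forall x n y, R ((x, n), y) -> exists y', R ((y, 0%N), y') &
      forall x n y, R ((x, n), y) -> forall m, exists y', R ((x, m), y')].
have [F Fgood Ftot|R [[RZ Rf Ri Rr Rt] Rmax]] := @Zorn_bigcup _ good.
  have two r r' : (\bigcup_(X in F) X) r -> (\bigcup_(X in F) X) r' ->
      exists X, [/\ F X, X r & X r'].
    case=> [X FX Xr] [X' FX' Xr']; have [XX'|X'X] := Ftot _ _ FX FX'.
      by exists X'; split=> //; exact: XX'.
    by exists X; split=> //; exact: X'X.
  split.
  - by move=> x n y [X /Fgood[XZ _ _ _ _] /XZ].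
  - move=> p y y' r r'; have [X [/Fgood[_ Xf _ _ _]]] := two _ _ r r'.
    exact: Xf.
  - move=> p p' y r r'; have [X [/Fgood[_ _ Xi _ _]]] := two _ _ r r'.
    exact: Xi.
  - move=> x n y [X FX Xr]; have [_ _ _ Xd _] := Fgood _ FX.
    by have [y' Xy'] := Xd _ _ _ Xr; exists y', X.
  - move=> x n y [X FX Xr] m; have [_ _ _ _ Xt] := Fgood _ FX.
    by have [y' Xy'] := Xt _ _ _ Xr m; exists y', X.
pose A := [set x | exists n y, R ((x, n), y)].
have AZ : A `<=` Z by move=> y [n [z /RZ]].
have AA : A `*` [set: nat] #<= A.
  apply/(card_le_injE z0).
  have /choice[f fP] : forall p : T * nat, exists y, A p.1 -> R (p, y).
    case=> x n; have [[k [z Rz]]|] := pselect (A x); last by exists x.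
    by have [y Ry] := Rt _ _ _ Rz n; exists y.
  exists f; split=> [[x n] [/fP/Rr[y Ry] _]|]; first by exists 0%N, y.
  by move=> p p' [/fP Rp _] [/fP Rp' _] ff; apply: Ri Rp _; rewrite ff.
(* If infinitely many points of [Z] were left over, an injective sequence [e] of them would extend
   [R], with a pairing of [nat] acting on its indices, against maximality. A finite remainder is
   absorbed afterwards. *)
have [Dinf|Dfin] := pselect (infinite_set (Z `\` A)).
  exfalso; have /(card_le_injE z0)[e [eZ eI]] := proj1 (infiniteP _) Dinf.
  have {}eI m n : e m = e n -> m = n by apply: eI.
  have eA n : ~ A (e n) by have [] := eZ n I.
  pose R' : set ((T * nat) * T) :=
    [set r | exists m n, r = ((e m, n), e (pickle (m, n)))].
  apply: (Rmax (R `|` R')); first split.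
  - by move=> r Rr'; left.
  - move=> sub; apply: (eA 0%N); exists 0%N, (e (pickle (0%N, 0%N))).
    by apply: sub; right; exists 0%N, 0%N.
  - split.
    + by move=> x n y [/RZ//|[m [k [-> _ _]]]]; have [] := eZ m I.
    + move=> [x k] y y' [r|[m [n [-> -> ->]]]] [r'|[m' [n' []]]].
      * exact: Rf r r'.
      * by move=> xe; case: (eA m'); rewrite -xe; exists k, y.
      * by case: (eA m); exists n, y'.
      * by move=> /eI -> -> ->.
    + move=> [x k] [x' k'] y [r|[m [n [-> -> ->]]]] [r'|[m' [n' []]]].
      * exact: Ri r r'.
      * move=> _ _ ye; case: (eA (pickle (m', n'))); rewrite -ye.
        by have [z Rz] := Rr _ _ _ r; exists 0%N, z.
      * case: (eA (pickle (m, n))).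
        by have [z Rz] := Rr _ _ _ r'; exists 0%N, z.
      * by move=> -> -> /eI /(pcan_inj pickleK)[-> ->].
    + move=> x n y [/Rr[z Rz]|[m [k [_ _ ->]]]]; first by exists z; left.
      by eexists; right; eexists; eexists.
    + move=> x n y [/Rt h m|[m [k [-> _ _]]] l].
        by have [y' Ry'] := h m; exists y'; left.
      by eexists; right; eexists; eexists.
have [y0 Ay0] : A !=set0.
  apply: contrapT => nA; apply: Dfin; suff -> : Z `\` A = Z by [].
  apply/seteqP; split=> [x []//|x Zx]; split=> // Ax.
  by apply: nA; exists x.
have ZA : Z #<= A.
  have Dc : countable (Z `\` A).
    by apply: finite_set_countable; exact: contrapT Dfin.
  apply: card_le_trans AA.
  apply: card_le_trans (setU_countable_le_setX Ay0 Dc).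
  apply: subset_card_le => x Zx.
  by have [Ax|nAx] := pselect (A x); [left|right].
apply: card_le_trans (subset_card_le AZ); apply: card_le_trans _ AA.
have /(card_le_injE z0)[f [fA fI]] := ZA.
apply/(card_le_injE (z0, 0%N)); exists (fun p => (f p.1, p.2)); split.
  by move=> p [Zp _]; split=> //; exact: fA.
by move=> [x n] [y m] [/= Zx _] [/= Zy _] [/fI -> // ->].
Qed.

Lemma small_le (K T T' : Type) (A : set T) (B : set T') :
  A #<= B -> small K B -> small K A.
Proof.
move=> AB [BK KB]; split; first exact: card_le_trans AB BK.
by move=> KA; apply: KB; exact: card_le_trans KA AB.
Qed.

Variables (K : Type) (Kunc : ~ countable [set: K]).

Lemma countable_small (T : Type) (A : set T) : countable A -> small K A.
Proof.
move=> cA; split; last by move=> /sub_countable/(_ cA).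
apply: card_le_trans cA _; apply/infiniteP => Kfin.
exact/Kunc/finite_set_countable.
Qed.

(** An infinite set absorbs a countable one, since its product with [nat] is no larger; a finite set
    gives a countable union, which is small because [K] is uncountable. *)
Lemma small_setU_countable (T : Type) (A D : set T) :
  small K A -> countable D -> small K (A `|` D).
Proof.
move=> sA cD.
have [Ainf|/contrapT Afin] := pselect (infinite_set A); last first.
  apply: countable_small; apply: countable_setU cD; exact: finite_set_countable.
have [z Az] := infinite_setN0 Ainf.
apply: small_le sA; apply: card_le_trans (infinite_setX_nat Ainf).
exact: setU_countable_le_setX Az cD.
Qed.

Lemma small_bigcup_range (I T : Type) (S : set (I -> T)) :
  countable [set: I] -> small K S -> small K (\bigcup_(a in S) range a).
Proof.
move=> cI sS.
have [Sinf|/contrapT Sfin] := pselect (infinite_set S); last first.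
  apply: countable_small; apply: bigcup_countable => [|a _].
    exact: finite_set_countable.
  exact: countable_range.
apply: small_le sS; apply: card_le_trans (infinite_setX_nat Sinf).
have -> : \bigcup_(a in S) range a = (fun p => p.1 p.2) @` (S `*` [set: I]).
  apply/seteqP; split=> [x [a Sa [i _ <-]]|_ [[a i] [Sa _] <-]].
    by exists (a, i).
  by exists a => //; exists i.
apply: card_le_trans (card_image_le _ _) _.
have [a0 Sa0] := infinite_setN0 Sinf.
have /countable_injP[c cinj] := cI.
apply/(card_le_injE (a0, 0%N)); exists (fun p => (p.1, c p.2)).
split=> [[a i] [Sa _]//|[a i] [b j] _ _ [-> /cinj]]; rewrite !inE => -> //.
Qed.

End Cardinality.

(** * Definable sets and compactness *)

(** Dependent choice where stage [n] only concerns the first [n] terms: term [i] is read off at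
    stage [i.+1], and later stages do not change it. *)
Lemma prefix_choice (X : Type) (P : nat -> (nat -> X) -> Prop) (t0 : nat -> X) :
  (forall n t t', (forall i, (i < n)%N -> t i = t' i) -> P n t -> P n t') ->
  P 0%N t0 ->
  (forall n t, P n t ->
     exists x, P n.+1 (fun i => if i == n then x else t i)) ->
  exists t, forall n, P n t.
Proof.
move=> Pext P0 PS.
pose T := {nt : nat * (nat -> X) | P nt.1 nt.2}.
pose R (p q : T) := (sval q).1 = (sval p).1.+1 /\
  forall i, (i < (sval p).1)%N -> (sval q).2 i = (sval p).2 i.
have next p : {q | R p q}.
  apply: cid; case: p => -[n t] /= Pt; have [x Px] := PS _ _ Pt.
  by exists (exist _ (n.+1, _) Px); split=> //= i ltin; rewrite ltn_eqF.
have [f [f0 fS]] := dependent_choice next (exist _ (0%N, t0) P0).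
have fn n : (sval (f n)).1 = n by elim: n => [|n IH]; rewrite ?f0// (fS n).1 IH.
have fE n k i : (i < n)%N -> (sval (f (k + n)%N)).2 i = (sval (f n)).2 i.
  move=> lt_in; elim: k => [//|k <-]; apply: (fS _).2.
  by rewrite fn ltn_addl.
exists (fun i => (sval (f i.+1)).2 i) => n.
have := svalP (f n); rewrite fn; apply: Pext => i lt_in.
by rewrite -(subnK lt_in) fE.
Qed.

Definition sumv (N I J : Type) (a : I -> N) (u : J -> N) (w : I + J) : N :=
  match w with inl i => a i | inr j => u j end.

Lemma ultra_fmap (T T' : Type) (f : T -> T') (V : set_system T) :
  UltraFilter V -> UltraFilter [set Z | V (f @^-1` Z)].
Proof.
move=> uV; split=> [|G pG VG]; first exact: (fmap_proper_filter f).
apply/seteqP; split=> [Z GZ|]; last exact: VG.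
have [//|VZ] := in_ultra_setVsetC (f @^-1` Z) uV.
by have [x []] := filter_ex (filterI GZ (VG (~` Z) VZ)).
Qed.

Section Definable.
Variables (L : language) (N : structure L).

Definition def_over (I : Type) (B : set N) (Z : set (I -> N)) : Prop :=
  exists phi : formula L (I + B), Z = [set a | sat phi (with_params a)].

(* Equivalent to [type_definable], but visibly monotone in [B]. *)
Definition closed_over (I : Type) (B : set N) (Z : set (I -> N)) : Prop :=
  forall t, (forall D, def_over B D -> Z `<=` D -> D t) -> Z t.

Lemma def_over_sat (I J : Type) (B : set N) (u : J -> N)
    (phi : formula L (I + J)) :
  (forall j, B (u j)) -> def_over B [set a | sat phi (sumv a u)].
Proof.
move=> Bu; pose r (w : I + J) : I + B :=
  match w with inl i => inl i | inr j => inr (SigSub (mem_set (Bu j))) end.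
exists (fren r phi); apply/seteqP.
have E a : @with_params L N I B a \o r = sumv a u by apply/funext => -[].
by split=> a /=; rewrite sat_fren E.
Qed.

Lemma def_over_satr (I J : Type) (B : set N) (u : J -> N)
    (phi : formula L (J + I)) :
  (forall j, B (u j)) -> def_over B [set a | sat phi (sumv u a)].
Proof.
move=> Bu; pose r (w : J + I) : I + J :=
  match w with inl j => inr j | inr i => inl i end.
have -> : [set a | sat phi (sumv u a)] = [set a | sat (fren r phi) (sumv a u)].
  rewrite predeqE => a /=; rewrite sat_fren.
  by have -> : sumv a u \o r = sumv u a by apply/funext => -[].
exact: def_over_sat.
Qed.

Lemma def_over_sub (I : Type) (B B' : set N) (Z : set (I -> N)) :
  B `<=` B' -> def_over B Z -> def_over B' Z.
Proof.
move=> BB' [phi ->]; apply: (@def_over_sat I B B' val) => b.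
by apply/BB'/set_mem; exact: valP.
Qed.

Lemma def_overI (I : Type) (B : set N) (Z Z' : set (I -> N)) :
  def_over B Z -> def_over B Z' -> def_over B (Z `&` Z').
Proof.
case=> phi -> [psi ->]; exists (FAnd phi psi).
by rewrite predeqE => a; split=> [h|/sat_FAnd//]; apply/sat_FAnd.
Qed.

Lemma def_overC (I : Type) (B : set N) (Z : set (I -> N)) :
  def_over B Z -> def_over B (~` Z).
Proof. by case=> phi ->; exists (FNot phi). Qed.

Lemma def_overT (I : Type) (B : set N) : def_over B [set: I -> N].
Proof. by exists (FNot (FFalse _ _)); apply/seteqP; split=> a //= _ []. Qed.

Lemma def_over_closed (I : Type) (B : set N) (Z : set (I -> N)) :
  def_over B Z -> closed_over B Z.
Proof. by move=> dZ t; exact. Qed.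

Lemma closed_over_sub (I : Type) (B B' : set N) (Z : set (I -> N)) :
  B `<=` B' -> closed_over B Z -> closed_over B' Z.
Proof.
move=> BB' cZ t Zt; apply: cZ => D dD ZD.
by apply: Zt => //; exact: def_over_sub dD.
Qed.

Lemma type_definable_closed (I : Type) (B : set N) (Z : set (I -> N)) :
  type_definable B Z -> closed_over B Z.
Proof.
case=> S -> t h phi Sphi.
by apply: (h [set a | sat phi (with_params a)]); [exists phi|move=> a; exact].
Qed.

Lemma type_definable_reindex (I J : Type) (B : set N) (Z : set (I -> N))
    (r : I -> J) :
  type_definable B Z -> closed_over B [set x : J -> N | Z (x \o r)].
Proof.
case=> S -> t h phi Sphi.
pose r' (w : I + B) : J + B :=
  match w with inl i => inl (r i) | inr b => inr b end.
have E (x : J -> N) : @with_params L N J B x \o r' = with_params (x \o r).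
  by apply/funext => -[].
have /= := h [set x | sat (fren r' phi) (with_params x)].
rewrite sat_fren E; apply=> [|x /= /(_ _ Sphi)]; first by eexists.
by rewrite sat_fren E.
Qed.

Lemma type_definable_fiber (I J : Type) (B : set N) (R : set (I + J -> N))
    (a : I -> N) :
  type_definable B R ->
  closed_over (B `|` range a) [set x : J -> N | R (sumv a x)].
Proof.
case=> S -> t h phi Sphi.
pose r (w : (I + J) + B) : J + (I + B) :=
  match w with
  | inl (inl i) => inr (inl i)
  | inl (inr j) => inl j
  | inr b => inr (inr b)
  end.
have E (x : J -> N) : sumv x (sumv a val) \o r =
    @with_params L N _ B (sumv a x) by apply/funext => -[[]|].
have /= := h [set x | sat (fren r phi) (sumv x (sumv a val))].
rewrite sat_fren E; apply.
  apply: def_over_sat => -[i|b]; first by right; exists i.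
  by left; apply: set_mem; exact: valP.
by move=> x /= /(_ _ Sphi); rewrite sat_fren E.
Qed.

Lemma finite_conjunction V (q F : set (formula L V)) :
  q (FNot (FFalse L V)) ->
  (forall phi psi, q phi -> q psi -> q (FAnd phi psi)) ->
  finite_set F -> F `<=` q ->
  exists2 psi, q psi &
    forall v : V -> N, sat psi v -> forall phi, F phi -> sat phi v.
Proof.
move=> qT qI /finite_setP[n /card_eqPle[/(card_le_injE 0%N)[f [fn fI]] _]].
elim: n F fn fI => [|n IH] F fn fI Fq.
  by exists (FNot (FFalse L V)) => // v _ phi /fn.
have [|||psi qpsi psiP] := IH [set phi | F phi /\ f phi <> n].
- move=> phi [/fn] /=; rewrite ltnS leq_eqVlt => /orP[/eqP//|//].
- by move=> phi psi [Fphi _] [Fpsi _]; exact: fI.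
- by move=> phi [/Fq].
have [[chi [Fchi chin]]|nex] := pselect (exists chi, F chi /\ f chi = n).
  exists (FAnd psi chi); first by apply: qI => //; exact: Fq.
  move=> v /sat_FAnd[psiv chiv] phi Fphi.
  have [fn'|fn'] := pselect (f phi = n); last exact: psiP.
  by rewrite (fI phi chi)// chin.
exists psi => // v psiv phi Fphi; apply: psiP => //; split=> // fn'.
by apply: nex; exists phi.
Qed.

(** * Realizing ultrafilters in a saturated structure *)

Section Saturation.
Variables (K : Type) (Kunc : ~ countable [set: K]) (Nsat : saturated K N).

(** Convertible to the valuation by which [sat] interprets a quantifier. *)
Definition optv (V : Type) (x : N) (v : V -> N) (w : option V) : N :=
  if w is Some y then v y else x.

(** Replaces the parameter sets of [saturated] by families with possible repetitions: every element
    of the range of [u] gets a chosen index, and formulas are renamed along this choice. *)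
Lemma saturated_indexed (J : Type) (u : J -> N)
    (q : set (formula L (option J))) :
  small K (range u) ->
  (forall phi, q phi \/ q (FNot phi)) ->
  (forall phi psi, q phi -> q psi -> q (FAnd phi psi)) ->
  (forall phi, q phi -> exists x, sat phi (optv x u)) ->
  exists x, forall phi, q phi <-> sat phi (optv x u).
Proof.
move=> su qC qI qS.
have /choice[j jE] : forall b : range u, exists j, u j = val b.
  by move=> b; have [j _ uj] := set_mem (valP b); exists j.
pose r (w : unit + range u) : option J :=
  match w with inl _ => None | inr b => Some (j b) end.
pose p := [set phi | q (fren r phi)].
have rE (a : unit -> N) : optv (a tt) u \o r = with_params a.
  by apply/funext => -[[]|b] //=; exact: jE.
have p_finsat : @finitely_satisfiable L N unit (range u) p.
  move=> F Ffin Fp.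
  have [||psi ppsi psiP] := finite_conjunction _ _ Ffin Fp.
  - have [//|/qS[x]] := qC (fren r (FNot (FFalse L (unit + range u)))).
    by case.
  - by move=> phi psi; rewrite /p /=; exact: qI.
  have [x /sat_fren psix] := qS _ ppsi.
  exists (fun=> x) => phi Fphi; apply: psiP Fphi.
  by rewrite -rE.
have p_complete phi : p phi \/ p (FNot phi) by exact: qC.
have [a tpa] := Nsat su (StoneType p_finsat p_complete).
have pE phi : p phi <-> sat phi (with_params a).
  have /= := congr1
    (fun s : stone_space unit (range u) => type_formulas s phi) tpa.
  by move=> <-.
exists (a tt) => phi.
have ru (i : J) : range u (u i) by exists i.
pose r' (w : option J) : unit + range u :=
  if w is Some i then inr (SigSub (mem_set (ru i))) else inl tt.
have r'E : @with_params L N _ _ a \o r' = optv (a tt) u by apply/funext => -[].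
have rr'E x : optv x u \o (r \o r') = optv x u.
  by apply/funext => -[i|] //=; rewrite jE.
(* Renaming forth and back replaces an index by one with the same parameter. The two formulas are
   thus equivalent at [u], and if [q] held one together with the negation of the other, it would
   contain an unsatisfiable conjunction. *)
have fren_fren : q (fren r (fren r' phi)) <-> q phi.
  have E x : sat (fren r (fren r' phi)) (optv x u) <-> sat phi (optv x u).
    by rewrite !sat_fren -[X in sat phi X]/(optv x u \o (r \o r')) rr'E.
  split=> h; [have [//|h'] := qC phi|have [//|h'] := qC (fren r (fren r' phi))];
    have [x /sat_FAnd[h1 h2]] := qS _ (qI _ _ h h'); exfalso.
  - by apply: h2; apply/E.
  - by apply: h2; apply/E.
have := pE (fren r' phi); rewrite sat_fren r'E => <-; exact: iff_sym.
Qed.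

(** Coordinates are realized one after the other. In [good n t] the first [n] terms of [t] have the
    type that [V] prescribes, while all later coordinates are frozen at [x0]. The limit works
    because a formula reads only finitely many coordinates. *)
Let realize_nat (J : Type) (u : J -> N) (V : set_system (nat -> N)) :
  small K (range u) -> UltraFilter V ->
  exists t, forall phi : formula L (nat + J),
    sat phi (sumv t u) <-> V [set m | sat phi (sumv m u)].
Proof.
move=> su uV; have [x0] := carrier_inhabited N.
pose trunc n (t : nat -> N) i := if (i < n)%N then t i else x0.
pose good n t := forall phi : formula L (nat + J),
  sat phi (sumv (trunc n t) u) <-> V [set m | sat phi (sumv (trunc n m) u)].
have VC Z : V (~` Z) <-> ~ V Z.
  split=> [VZ VZ'|nVZ]; last by have [] := in_ultra_setVsetC Z uV.
  by have [x []] := filter_ex (filterI VZ VZ').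
have VT (Q : Prop) : V [set _ | Q] <-> Q.
  split=> [/filter_ex[_]//|Qt].
  by apply: filterS (@filterT _ V _) => x _.
have [||n t gt|t tgood] := @prefix_choice N good (fun=> x0).
- move=> n t t' tt' gt phi; rewrite -gt.
  suff -> : trunc n t' = trunc n t by [].
  by apply/funext => i; rewrite /trunc; case: ltnP => // /tt'.
- by move=> phi; exact: iff_sym (VT _).
- pose w n m (x : option (nat + J)) := optv (m n) (sumv (trunc n m) u) x.
  (* The type that [V] prescribes for coordinate [n], over the terms of [t] found so far. It is
     satisfiable there because [gt] applies to the existential quantification of each of its
     formulas. *)
  pose q := [set phi | V [set m | sat phi (w n m)]].
  have [||||x xP] := @saturated_indexed (nat + J) (sumv (trunc n t) u) q.
  + have sB := small_setU_countable Kunc su (countable_range t (countableP _)).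
    apply: small_le (small_setU_countable Kunc sB (countable1 x0)).
    apply: subset_card_le => _ [[i|j] _ <-] /=; last by left; left; exists j.
    by rewrite /trunc; case: ltnP => _; [left; right; exists i|right].
  + move=> phi; rewrite /q /=.
    by have [h|/VC h] := pselect (V [set m | sat phi (w n m)]); [left|right].
  + move=> phi psi qphi qpsi; rewrite /q /=.
    by apply: filterS (filterI qphi qpsi) => m h; apply/sat_FAnd.
  + move=> phi qphi; apply/sat_FEx; apply/gt; apply: filterS qphi => m phim.
    by apply/sat_FEx; exists (m n).
  exists x => phi.
  pose r (z : nat + J) : option (nat + J) :=
    match z with inl i => if i == n then None else Some z | inr _ => Some z end.
  have E (y : N) (s : nat -> N) : s n = y ->
      optv y (sumv (trunc n s) u) \o r = sumv (trunc n.+1 s) u.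
    move=> sn; apply/funext => -[i|j] //=.
    have [->|ni] := eqVneq i n; rewrite /= /trunc; first by rewrite ltnSn.
    by rewrite ltnS [(i <= n)%N]leq_eqVlt (negbTE ni).
  have tE : trunc n (fun i => if i == n then x else t i) = trunc n t.
    by apply/funext => i; rewrite /trunc; case: ltnP => // /ltn_eqF ->.
  rewrite -(@E x) ?eqxx// tE -sat_fren -xP /q /=.
  by split; apply: filterS => m /=; rewrite sat_fren E.
exists t => phi.
pose e (z : nat + J) := if z is inl i then i else 0%N.
have [n nP] := sat_depends_below N e phi.
have E s : sat phi (sumv s u) <-> sat phi (sumv (trunc n s) u).
  by apply: nP => -[i|j] //= lt_in; rewrite /trunc lt_in.
rewrite E tgood; split; apply: filterS => m /=; first by rewrite -E.
by move/(E m).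
Qed.

Lemma realize_ultra (I : Type) (B : set N) (V : set_system (I -> N)) :
  countable [set: I] -> small K B -> UltraFilter V ->
  exists t, forall Z, def_over B Z -> Z t <-> V Z.
Proof.
move=> /countable_injP[e eI] sB uV.
have [x0] := carrier_inhabited N.
have /choice[d dE] : forall m : I -> N, exists m' : nat -> N, m' \o e = m.
  move=> m.
  have /choice[m' m'E] : forall n, exists y, forall i, e i = n -> y = m i.
    move=> n; have [[i ein]|nex] := pselect (exists i, e i = n); last first.
      by exists x0 => i ein; case: nex; exists i.
    exists (m i) => j ejn; congr m; apply: eI; rewrite ?inE//.
    by rewrite ein.
  by exists m'; apply/funext => i; exact: m'E.
have su : small K (range (val : B -> N)).
  apply: small_le sB; apply: subset_card_le => _ [b _ <-].
  by apply: set_mem; exact: valP.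
pose W : set_system (nat -> N) := [set Z | V [set m | Z (d m)]].
have uW : UltraFilter W := ultra_fmap d uV.
have [t tP] := realize_nat su uW; exists (t \o e) => _ [phi ->].
pose r (w : I + B) : nat + B :=
  match w with inl i => inl (e i) | inr b => inr b end.
have E s : sumv s val \o r = @with_params L N I B (s \o e).
  by apply/funext => -[].
rewrite /= -E -sat_fren tP /W /=.
by split; apply: filterS => m /=; rewrite sat_fren E dE.
Qed.

(** Definable supersets of a member of [F] belong to any ultrafilter extending [F], hence contain
    the point that realizes this ultrafilter over [B]. *)
Lemma compactness (I : Type) (B : set N) (F : set_system (I -> N)) :
  countable [set: I] -> small K B -> ProperFilter F ->
  exists t, forall Z, F Z -> closed_over B Z -> Z t.
Proof.
move=> cI sB pF; have [V [uV FV]] := ultraFilterLemma pF.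
have [t tP] := realize_ultra cI sB uV; exists t => Z FZ cZ.
by apply: cZ => D dD ZD; apply/tP => //; apply: filterS ZD _; exact: FV.
Qed.

End Saturation.
End Definable.

(** * Types over models and bounded equivalence relations *)

Section SameType.
Variables (L : language) (N : structure L).

Definition same_type (I : Type) (u v : I -> N) : Prop :=
  forall phi : formula L I, sat phi u <-> sat phi v.

Lemma homogeneous_tuple (K I : Type) (u v : I -> N) :
  ~ countable [set: K] -> homogeneous K N -> countable [set: I] ->
  same_type u v -> exists2 s, automorphism s & s \o u = v.
Proof.
move=> Kunc Nhom cI uv.
have /choice[j jE] : forall b : range u, exists j, u j = val b.
  by move=> b; have [j _ uj] := set_mem (valP b); exists j.
have su : small K (range u).
  by apply: countable_small => //; exact: countable_range.
have [|s sa sE] := @Nhom _ (v \o j) su.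
  move=> phi; rewrite -sat_fren -uv sat_fren.
  by have -> : u \o j = val by apply/funext.
exists s => //; apply/funext => i.
have ui : u i \in range u by apply/mem_set; exists i.
rewrite /= (sE (SigSub ui)) /=.
(* The entries of [u] may repeat, so the index chosen for [u i] need not be [i]; the equality of the
   two entries carries over to [v]. *)
have /= := uv (FEq (TVar L (j (SigSub ui))) (TVar L i)).
by rewrite jE /= => -[->].
Qed.

(** The formula reads only variables with code below [n]. Quantifying these existentially gives a
    formula with parameters in [M], to which elementarity applies; the remaining coordinates get the
    default value [m0]. *)
Lemma elementary_tuple (I : Type) (M : set N) (phi : formula L (I + M))
    (a : I -> N) :
  countable [set: I] -> elementary_substructure M ->
  sat phi (with_params a) ->
  exists m : I -> M, sat phi (with_params (val \o m)).
Proof.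
move=> /countable_injP[c cI] [M0 [Mf el]] phia.
have [x0 Mx0] := M0; pose m0 : M := SigSub (mem_set Mx0).
pose e (w : I + M) := if w is inl i then c i else 0%N.
pose P : set (I + M) := [set w | exists i, w = inl i].
have eI : {in P &, injective e}.
  move=> x y; rewrite !inE => -[i ->] [j ->] /= cij; congr inl.
  by apply: cI; rewrite ?inE.
have [n nP] := sat_depends_below N e phi.
have [psi psiE] := exists_closure n phi eI.
pose v0 (w : I + M) : substructure M0 Mf :=
  match w with inl _ => m0 | inr b => b end.
have /el/psiE[w wv0 /el phiw] : sat psi (val \o v0).
  apply/psiE.
  exists (fun w => if (e w < n)%N then with_params a w else val (v0 w)).
    move=> [i|b] /=; last by case: ifP.
    by case: ifP => // lt_n; case; split=> //; exists i.
  by rewrite (nP _ (with_params a))// => x ->.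
exists (w \o inl).
suff <- : (fun x => val (w x)) = with_params (val \o (w \o inl)) by [].
by apply/funext => -[//|b] /=; rewrite wv0// => -[[]].
Qed.

End SameType.

Section Bounded.
Variables (L : language) (N : structure L) (K : Type).
Hypotheses (Kunc : ~ countable [set: K]) (Nsat : saturated K N).
Hypotheses (Nhom : homogeneous K N).
Variables (I : Type) (X : set (I -> N)) (E : set ((I -> N) * (I -> N))).
Hypotheses (cI : countable [set: I]) (Einv : aut_invariant (flatten_rel E)).
Hypotheses (Eeq : equivalence_on X E) (Ebd : bounded_on K X E).

Lemma aut_rel (s : N -> N) a b : automorphism s ->
  E (a, b) -> E (s \o a, s \o b).
Proof.
move=> sa Eab; have : flatten_rel E (s \o sumv a b).
  by rewrite -(Einv sa); exists (sumv a b).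
by [].
Qed.

Lemma same_type_rel a b a' b' :
  same_type (sumv a b) (sumv a' b') -> E (a, b) -> E (a', b').
Proof.
move=> st Eab.
have cII : countable [set: I + I].
  have -> : [set: I + I] = inl @` [set: I] `|` inr @` [set: I].
    by apply/seteqP; split=> // -[i|i] _; [left|right]; exists i.
  by apply: countable_setU; exact: countable_range.
have [s sa sE] := homogeneous_tuple Kunc Nhom cII st.
have := aut_rel sa Eab.
have -> : s \o a = a' by apply/funext => i; have := congr1 (@^~ (inl i)) sE.
by have -> : s \o b = b' by apply/funext => i; have := congr1 (@^~ (inr i)) sE.
Qed.

(* A maximal set of pairwise inequivalent elements of [H] is small, since [E]
   is bounded. *)
Lemma bounded_rel (H : set (I -> N)) a b : H `<=` X ->
  (forall S, S `<=` H -> small K S ->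
     exists2 t, H t & forall s, S s -> same_type (sumv t s) (sumv a b)) ->
  E (a, b).
Proof.
move=> HX Hext; apply: contrapT => nEab.
pose good (S : set (I -> N)) := S `<=` H /\
  forall s s', S s -> S s' -> E (s, s') -> s = s'.
have [F Fgood Ftot|S [[SH SE] Smax]] := @Zorn_bigcup _ good.
  split=> [s [Z /Fgood[ZH _] /ZH]//|s s' [Z FZ Zs] [Z' FZ' Zs']].
  have [ZZ'|Z'Z] := Ftot _ _ FZ FZ'.
    by have [_ h] := Fgood _ FZ'; apply: h => //; exact: ZZ'.
  by have [_ h] := Fgood _ FZ; apply: h => //; exact: Z'Z.
have [Er Es _] := Eeq.
have sS : small K S.
  apply: small_le Ebd; apply/(card_le_injE set0).
  exists (fun s => [set b | X b /\ E (s, b)]); split=> [s Ss|s s' Ss Ss' ss'].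
    by exists s => //; exact/HX/SH.
  apply: SE => //; have Xs' := HX _ (SH _ Ss').
  have : [set b | X b /\ E (s', b)] s' by split=> //; exact: Er.
  by rewrite -ss' => -[].
have [t Ht tS] := Hext _ SH sS.
have nE s : S s -> ~ E (t, s).
  by move=> Ss Ets; apply: nEab; apply: same_type_rel Ets; exact: tS.
apply: (Smax (S `|` [set t])); split.
- by move=> s Ss; left.
- by move=> /(_ t) h; apply: (nE t); [apply: h; right|exact/Er/HX].
- by move=> s [/SH//|->].
- move=> s s' [Ss|->] [Ss'|->] // Ess'; first exact: SE.
  + by case: (nE s Ss); apply: Es Ess'; [exact/HX/SH|exact: HX].
  + by case: (nE s' Ss').
Qed.

Lemma tp_def_over (M : set N) (a b : I -> N) (D : set (I -> N)) :
  tp M a = tp M b -> def_over M D -> D a <-> D b.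
Proof.
move=> tpab [phi ->].
have /= := congr1 (fun p : stone_space I M => type_formulas p phi) tpab.
by move=> ->.
Qed.

(* [E] is coarser than having the same type over a model: a realization [c]
   of a global coheir of [tp M a] over [a] and [b] is equivalent to both. *)
Lemma model_type_rel (M : set N) a b :
  elementary_substructure M -> countable M -> closed_over M X ->
  X a -> tp M a = tp M b -> E (a, b).
Proof.
move=> elM cM cX Xa tpab.
pose D0 := [set phi : formula L (I + M) | sat phi (with_params a)].
(* An ultrafilter above this filter is a coheir: it contains the set of tuples from [M] and all the
   sets definable over [M] to which [a] belongs. *)
pose F0 := filter_from D0 (fun phi =>
  [set m : I -> N | (forall i, M (m i)) /\ sat phi (with_params m)]).
have pF0 : ProperFilter F0.
  apply: filter_from_proper => [|phi phia].
    apply: filter_from_filter; first by exists (FNot (FFalse _ _)).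
    move=> phi psi phia psia; exists (FAnd phi psi); first exact/sat_FAnd.
    by move=> m /= [Mm /sat_FAnd[]].
  have [m phim] := elementary_tuple cI elM phia.
  by exists (val \o m); split=> // i; apply: set_mem; exact: valP.
have [V [uV F0V]] := ultraFilterLemma pF0.
have VM : V [set m | forall i, M (m i)].
  by apply: F0V; exists (FNot (FFalse _ _)) => // m [].
have Vtp D : def_over M D -> V D <-> D a.
  move=> [phi ->]; split=> [VD|phia]; last first.
    by apply: F0V; exists phi => // m [].
  apply: contrapT => na.
  have /F0V Vn : F0 [set m | ~ sat phi (with_params m)].
    by exists (FNot phi) => // m [].
  by have [m []] := filter_ex (filterI VD Vn).
pose H := [set s : I -> N | forall D, def_over M D -> D s <-> D a].
have HX : H `<=` X.
  move=> s Hs; apply: cX => D dD XD.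
  by apply/Hs => //; exact: XD.
(* Since [V] concentrates on tuples [m] from [M], and [s] has the type of [a] over [M], the tuple
   [s] may be replaced by [a] in [chi]. Hence the type of [t] with [s] does not depend on [s]. *)
have key S : S `<=` H -> small K S -> exists2 t, H t &
    forall s, S s -> forall chi : formula L (I + I), sat chi (sumv t s) <->
      V [set m | sat chi (sumv m a)].
  move=> SH sS.
  have sB := small_setU_countable Kunc (small_bigcup_range Kunc cI sS) cM.
  have [t tP] := realize_ultra Kunc Nsat cI sB uV; exists t.
    move=> D dD; rewrite -Vtp//; apply: tP; apply: def_over_sub dD.
    by move=> x; right.
  move=> s Ss chi.
  have ds : def_over (\bigcup_(s in S) range s `|` M)
      [set m | sat chi (sumv m s)].
    by apply: def_over_sat => i; left; exists s => //; exists i.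
  apply: iff_trans (tP _ ds) _.
  have ms m : (forall i, M (m i)) -> sat chi (sumv m s) <-> sat chi (sumv m a).
    by move=> Mm; exact: (SH _ Ss _ (def_over_satr chi Mm)).
  by split=> h; apply: filterS (filterI VM h) => m [Mm hm]; apply/(ms m Mm).
have sab : small K [set a; b].
  by apply: countable_small => //; exact: finite_set_countable.
have [|c Hc cP] := key _ _ sab.
  move=> _ [->|->] D dD; first exact: iff_refl.
  exact: iff_sym (tp_def_over tpab dD).
(* By [key], the pairs formed by [t] and any [s] in [S] have the same type as the pair of [c] and
   [d], as [bounded_rel] requires. *)
have Ec d : [set a; b] d -> E (c, d).
  move=> dab; apply: (@bounded_rel H) => // S SH sS.
  have [t Ht tS] := key _ SH sS; exists t => // s Ss chi.
  by rewrite tS// cP.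
have [_ Es Et] := Eeq.
have Xb : X b by apply: HX => D dD; exact: iff_sym (tp_def_over tpab dD).
have Xc := HX _ Hc.
have Eca : E (c, a) by apply: Ec; left.
have Ecb : E (c, b) by apply: Ec; right.
exact: Et Xa Xc Xb (Es _ _ Xc Xa Eca) Ecb.
Qed.

End Bounded.

(** * Thick formulas *)

Lemma filter_below (T : Type) (F : set_system T) (Z : nat -> set T) n :
  Filter F -> (forall i, (i < n)%N -> F (Z i)) ->
  F [set x | forall i, (i < n)%N -> Z i x].
Proof.
move=> fF; elim: n => [|n IH] FZ; first by apply: filterS (@filterT _ F _).
apply: filterS (filterI (IH _) (FZ n (ltnSn n))) => [x [Zx Znx] i|i lt_in].
  by rewrite ltnS leq_eqVlt => /orP[/eqP ->//|]; exact: Zx.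
by apply: FZ; exact: ltnW.
Qed.

Lemma def_over_reindex (L : language) (N : structure L) (V J : Type) (B : set N)
    (phi : formula L V) (r : V -> J) :
  def_over B [set z : J -> N | sat phi (z \o r)].
Proof.
exists (fren (inl \o r) phi); rewrite predeqE => z /=; rewrite sat_fren.
by have -> : with_params z \o (inl \o r) = z \o r by [].
Qed.

Section Thick.
Variables (L : language) (N : structure L) (I : Type).

Definition thick (C : set (I -> N)) (theta : formula L (I + I)) : Prop :=
  forall V : set_system (I -> N), UltraFilter V -> V C ->
    V [set x | V [set y | sat theta (sumv x y)]].

Lemma thickI C theta theta' :
  thick C theta -> thick C theta' -> thick C (FAnd theta theta').
Proof.
move=> tt tt' V uV VC; apply: filterS (filterI (tt V uV VC) (tt' V uV VC)).
move=> x [Vx V'x]; apply: filterS (filterI Vx V'x) => y h; exact/sat_FAnd.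
Qed.

Lemma thickT C : thick C (FNot (FFalse L (I + I))).
Proof.
move=> V uV _; apply: filterS (@filterT _ V _) => x _.
by apply: filterS (@filterT _ V _) => y _ /=.
Qed.

(** An ultrafilter witnessing the failure plays the part of Ramsey's theorem: each new term is taken
    in [G] and in the finitely many large sets given by the earlier terms. *)
Lemma not_thick_sequence C chi n : ~ thick C (FNot chi) ->
  exists x : nat -> I -> N, (forall i, (i < n)%N -> C (x i)) /\
    (forall i j, (i < j < n)%N -> sat chi (sumv (x i) (x j))).
Proof.
move=> nt; have [V [uV [VC Vchi]]] : exists V : set_system (I -> N),
    UltraFilter V /\ (V C /\ V [set x | V [set y | sat chi (sumv x y)]]).
  apply: contrapT => nV; apply: nt => V uV VC; apply: contrapT => nn.
  apply: nV; exists V; split=> //; split=> //.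
  have [//|] := in_ultra_setVsetC [set x | V [set y | ~ sat chi (sumv x y)]] uV.
  apply: filterS => x nx.
  by have [//|] := in_ultra_setVsetC [set y | sat chi (sumv x y)] uV.
pose G := C `&` [set x | V [set y | sat chi (sumv x y)]].
suff [x [xG xchi]] : exists x : nat -> I -> N,
    (forall i, (i < n)%N -> G (x i)) /\
    (forall i j, (i < j < n)%N -> sat chi (sumv (x i) (x j))).
  by exists x; split=> // i /xG[].
elim: n => [|n [x [xG xchi]]].
  have [x0] := carrier_inhabited N.
  by exists (fun=> fun=> x0); split=> // i j; rewrite ltn0 andbF.
have /filter_ex[y [Gy ychi]] :
    V (G `&` [set y | forall i, (i < n)%N -> sat chi (sumv (x i) y)]).
  apply: filterI; first exact: filterI.
  by apply: filter_below => i /xG[].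
exists (fun i => if i == n then y else x i); split=> [i|i j].
  by rewrite ltnS leq_eqVlt; case: eqP => [-> //|_ /=]; exact: xG.
rewrite ltnS [(j <= n)%N]leq_eqVlt; case: (eqVneq j n) => [->|jn] /=.
  by rewrite andbT => lt_in; rewrite ltn_eqF//; exact: ychi.
move=> /andP[lt_ij lt_jn]; rewrite ltn_eqF ?(ltn_trans lt_ij)//.
by apply: xchi; rewrite lt_ij.
Qed.

Variables (K : Type) (Kunc : ~ countable [set: K]) (Nsat : saturated K N).
Hypotheses (Nhom : homogeneous K N).
Variables (X : set (I -> N)) (E : set ((I -> N) * (I -> N))) (A : set N).
Hypotheses (cI : countable [set: I]) (Einv : aut_invariant (flatten_rel E)).
Hypotheses (Eeq : equivalence_on X E) (Ebd : bounded_on K X E).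
Hypotheses (cA : countable A) (dX : type_definable A X).

(** No formula true of [a] and [b] has a thick negation, so each holds along arbitrarily long
    sequences in [C]. By compactness some infinite sequence in [X] has all its increasing pairs of
    the type of [a] and [b], and boundedness makes [E] hold for this type. *)
Lemma thick_rel C a b : C `<=` X -> X a ->
  (forall theta, thick C theta -> sat theta (sumv a b)) -> E (a, b).
Proof.
move=> CX Xa thab.
pose el (z : nat * I -> N) i : I -> N := z \o pair i.
pose D0 := [set p : formula L (I + I) * nat | sat p.1 (sumv a b)].
pose F0 := filter_from D0 (fun p => [set z | (forall i, X (el z i)) /\
  forall i j, (i < j < p.2)%N -> sat p.1 (sumv (el z i) (el z j))]).
have pF0 : ProperFilter F0.
  apply: filter_from_proper => [|[chi n] /= chiab].
    apply: filter_from_filter; first by exists (FNot (FFalse _ _), 0%N).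
    move=> [phi n] [psi m] /= phiab psiab.
    exists (FAnd phi psi, maxn n m); first exact/sat_FAnd.
    move=> z [Xz zP]; split; split=> // i j /andP[ij jn] /=.
      have ijM : (i < j < maxn n m)%N by rewrite ij leq_max jn.
      by have /sat_FAnd[] := zP i j ijM.
    have ijM : (i < j < maxn n m)%N by rewrite ij leq_max jn orbT.
    by have /sat_FAnd[] := zP i j ijM.
  have [|x [xC xchi]] := @not_thick_sequence C chi n.
    by move=> /thab /=; apply.
  (* Terms from [n] on are set to [a], to keep the whole sequence in [X]. *)
  pose xa k := if (k < n)%N then x k else a.
  exists (fun p => xa p.1 p.2); split=> [k|i j /andP[lt_ij lt_jn]].
    by rewrite -[el _ k]/(xa k) /xa; case: ltnP => // /xC/CX.
  rewrite -[el _ i]/(xa i) -[el _ j]/(xa j) /xa lt_jn (ltn_trans lt_ij)//.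
  by apply: xchi; rewrite lt_ij.
have cnI : countable [set: nat * I].
  by rewrite -setXTT; apply: countableX.
have [z zP] := compactness Kunc Nsat cnI (countable_small Kunc cA) pF0.
have Xz i : X (el z i).
  apply: (zP [set z | X (el z i)]); last exact: type_definable_reindex.
  by exists (FNot (FFalse _ _), 0%N) => // y [+ _]; apply.
have ztype i j : (i < j)%N -> same_type (sumv (el z i) (el z j)) (sumv a b).
  move=> lt_ij.
  have sub phi : sat phi (sumv a b) -> sat phi (sumv (el z i) (el z j)).
    move=> phiab; apply: (zP [set z | sat phi (sumv (el z i) (el z j))]).
      by exists (phi, j.+1) => // y [_]; apply; rewrite lt_ij /=.
    apply: def_over_closed.
    pose r (w : I + I) := match w with inl k => (i, k) | inr k => (j, k) end.
    have -> : [set z | sat phi (sumv (el z i) (el z j))] =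
        [set z : nat * I -> N | sat phi (z \o r)].
      rewrite predeqE => y /=; suff -> : y \o r = sumv (el y i) (el y j) by [].
      by apply/funext => -[].
    exact: def_over_reindex.
  move=> phi; split=> [phiz|/sub//].
  by apply: contrapT => /(sub (FNot phi)); apply.
have [V0 [uV0 V0oo]] := ultraFilterLemma eventually_filter.
pose V := [set Z | V0 ((el z) @^-1` Z)].
have uV : UltraFilter V := ultra_fmap (el z) uV0.
(* Points that may follow all terms of the sequence. The limit [t] of the sequence along a free
   ultrafilter, realized over [S] as well, is again such a point, and with any [s] in [S] it has the
   type of the pairs formed by a term and [s]. *)
pose H := [set s | X s /\ forall i, same_type (sumv (el z i) s) (sumv a b)].
apply: (@bounded_rel _ _ _ Kunc Nhom _ X E cI Einv Eeq Ebd H) => [s []//|].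
move=> S SH sS.
pose D := A `|` range z.
have cD : countable D.
  by apply: countable_setU => //; exact: countable_range.
have sB := small_setU_countable Kunc (small_bigcup_range Kunc cI sS) cD.
have [t tP] := realize_ultra Kunc Nsat cI sB uV.
have same_typeW (u v : I + I -> N) :
    (forall phi, sat phi u -> sat phi v) -> same_type v u.
  move=> uv phi; split=> [phiv|/uv//].
  by apply: contrapT => /(uv (FNot phi)); apply.
exists t.
  split.
    apply: (type_definable_closed dX) => Z dZ XZ.
    apply/tP; first by apply: def_over_sub dZ => x Ax; right; left.
    have VT : V0 setT by exact: filterT.
    suff: V0 (el z @^-1` Z) by [].
    by apply: filterS VT => i _; apply: XZ; exact: Xz.
  move=> i; apply: same_typeW => phi phiab.
  apply/(tP [set t | sat phi (sumv (el z i) t)]).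
    by apply: def_over_satr => k; right; right; exists (i, k).
  apply: V0oo; exists i.+1 => // j /= lt_ij.
  by apply/(ztype i j lt_ij).
move=> s Ss; apply: same_typeW => phi phiab.
apply/(tP [set t | sat phi (sumv t s)]).
  by apply: def_over_sat => k; left; exists s => //; exists k.
suff: V0 (el z @^-1` [set t | sat phi (sumv t s)]) by [].
apply: filterS (@filterT _ V0 _) => i _.
by have [_ h] := SH _ Ss; apply/(h i phi).
Qed.

End Thick.

(** * Positive sets *)

(** If no finite union of translates of [D] were in [F], then adding the complements of all
    translates of [D] would give a proper invariant filter, strictly larger since it contains the
    complement of [D]. *)
Lemma maximal_invariant_filter (T : Type) (G : set (T -> T)) (C : set T) :
  C !=set0 -> G id -> (forall g h, G g -> G h -> G (g \o h)) ->
  (forall g, G g -> C `<=` g @^-1` C) ->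
  exists F : set_system T, [/\ ProperFilter F, F C,
    forall g Z, G g -> F Z -> F (g @^-1` Z) &
    forall D, ~ F (~` D) -> exists n (g : nat -> T -> T),
      (forall k, G (g k)) /\ F [set a | exists2 k, (k < n)%N & D (g k a)]].
Proof.
move=> C0 G1 GM GC.
pose inv (F : set_system T) := [/\ ProperFilter F, F C &
  forall g Z, G g -> F Z -> F (g @^-1` Z)].
(* [set0] is admitted because of the empty chain. *)
pose good (F : set_system T) := F = set0 \/ inv F.
have [Fs Fsgood Ftot|F [[F0|[pF FC Finv]] Fmax]] := @Zorn_bigcup _ good.
- have [[F [FsF [Z FZ]]]|nF] :=
    pselect (exists F, Fs F /\ F !=set0); last first.
    left; apply/seteqP; split=> // Z [F FsF FZ]; apply: nF.
    by exists F; split=> //; exists Z.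
  have inv_of F' Z' : Fs F' -> F' Z' -> inv F'.
    by move=> /Fsgood[->|].
  have up F' Z' : Fs F' -> F' Z' ->
      exists F'', [/\ Fs F'', inv F'', F `<=` F'' & F' `<=` F''].
    move=> FsF' FZ'; have [FF'|F'F] := Ftot _ _ FsF FsF'.
      by exists F'; split=> //; exact: inv_of FZ'.
    by exists F; split=> //; exact: inv_of FZ.
  right; have [pF FC Finv] := inv_of _ _ FsF FZ; split.
  + split; first by move=> [F' FsF' F'0]; have [[[]]] := inv_of _ _ FsF' F'0.
    split.
    * by exists F => //; exact: filterT.
    * move=> P Q [F1 FsF1 F1P] [F2 FsF2 F2Q].
      have [F3 [FsF3 [pF3 _ _] _ F13]] := up _ _ FsF1 F1P.
      have [F23|F32] := Ftot _ _ FsF2 FsF3.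
        by exists F3 => //; apply: filterI; [exact: F13|exact: F23].
      have [pF2 _ _] := inv_of _ _ FsF2 F2Q.
      by exists F2 => //; apply: filterI => //; exact/F32/F13.
    * move=> P Q PQ [F1 FsF1 F1P]; have [pF1 _ _] := inv_of _ _ FsF1 F1P.
      by exists F1 => //; exact: filterS F1P.
  + by exists F.
  + move=> g P Gg [F1 FsF1 F1P]; have [_ _ h] := inv_of _ _ FsF1 F1P.
    by exists F1 => //; exact: h.
- exfalso; apply: (Fmax [set Z | C `<=` Z]).
    rewrite F0; split=> // /(_ C); exact.
  right; split=> //.
    split; first by case: C0 => c Cc /(_ c Cc).
    split=> // [P Q CP CQ c Cc|P Q PQ CP]; last exact: subset_trans PQ.
    by split; [exact: CP|exact: CQ].
  by move=> g Z Gg CZ c Cc; apply: CZ; exact: GC.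
exists F; split=> // D nFD; apply: contrapT => nD.
pose J := (set T * (nat * (nat -> T -> T)))%type.
pose D0 : set J := [set p | F p.1 /\ forall k, G (p.2.2 k)].
pose b (p : J) := p.1 `&` [set a | forall k, (k < p.2.1)%N -> ~ D (p.2.2 k a)].
pose F' := filter_from D0 b.
have FF' : F `<=` F'.
  by move=> Z FZ; exists (Z, (0%N, fun=> id)) => // a [].
apply: (Fmax F'); first split => //.
  move=> F'F; apply: nFD; apply: F'F.
  exists (setT, (1%N, fun=> id)) => [|a [_ /(_ 0%N)]]; last exact.
  by split=> //; exact: filterT.
right; split; last 2 first.
- exact: FF'.
- move=> g Z Gg [[W [n h]] [/= FW Gh] WZ].
  exists (g @^-1` W, (n, fun k => h k \o g)).
    by split=> [|k]; [exact: Finv|exact: GM].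
  by move=> a [Wa ha]; apply: WZ.
apply: filter_from_proper.
  apply: filter_from_filter.
    by exists (setT, (0%N, fun=> id)); split=> //; exact: filterT.
  move=> [W [n g]] [W' [n' g']] [/= FW Gg] [/= FW' Gg'].
  exists (W `&` W',
    ((n + n')%N, fun k => if (k < n)%N then g k else g' (k - n)%N)).
    by split=> [|k] /=; [exact: filterI|case: ifP].
  move=> a [[/= Wa W'a] h]; split; split=> //= k lt_k.
    by have := h k; rewrite lt_k; apply; exact: ltn_addr.
  have nk : (n + k < n)%N = false by rewrite ltnNge leq_addr.
  by have := h (n + k)%N; rewrite nk addKn; apply; rewrite ltn_add2l.
move=> [W [n g]] [/= FW Gg]; apply: contrapT => nb; apply: nD.
exists n, g; split=> //; apply: filterS FW => a Wa; apply: contrapT => na.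
by apply: nb; exists a; split=> // k kn Dk; apply: na; exists k.
Qed.

Section Dynamics.
Variables (L : language) (N : structure L) (K : Type).
Hypotheses (Kunc : ~ countable [set: K]) (Nsat : saturated K N).
Hypotheses (Nhom : homogeneous K N).
Variables (I : Type) (X C : set (I -> N)) (E : set ((I -> N) * (I -> N))).
Variables (A : set N) (Gamma : set (N -> N)).
Hypotheses (cI : countable [set: I]) (Einv : aut_invariant (flatten_rel E)).
Hypotheses (Eeq : equivalence_on X E) (Ebd : bounded_on K X E).
Hypotheses (cA : countable A) (dX : type_definable A X).
Hypotheses (clC : is_class X E C) (Gsub : automorphism_subgroup Gamma).
Hypotheses (Gtrans : transitive_on C Gamma).
Hypotheses (Gpres : preserves_classes X E Gamma).

Lemma class_sub : C `<=` X.
Proof. by have [a Xa ->] := clC => b []. Qed.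

Lemma Gamma_rel g a : Gamma g -> X a -> X (g \o a) /\ E (a, g \o a).
Proof.
move=> Gg Xa; pose Ca := [set b | X b /\ E (a, b)].
have clCa : is_class X E Ca by exists a.
have [Er _ _] := Eeq.
have : ((fun b => g \o b) @` Ca) (g \o a).
  by exists a => //; split=> //; exact: Er.
by rewrite (Gpres Gg clCa).
Qed.

Lemma Gamma_class g a : Gamma g -> C a -> C (g \o a).
Proof.
move=> Gg Ca; have := Gpres Gg clC.
by move=> <-; exists a.
Qed.

Lemma Gamma_aut g : Gamma g -> automorphism g.
Proof. by have [h _ _ _] := Gsub; exact: h. Qed.

Lemma Gamma_inv g : Gamma g -> exists h, [/\ Gamma h, cancel g h & cancel h g].
Proof. by have [_ _ _ h] := Gsub; exact: h. Qed.

(** The parameter set is not fixed, because [Gamma] moves it. *)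
Definition definable (Z : set (I -> N)) :=
  exists2 B, countable B & def_over B Z.

(** For [g] in [Gamma] this is the image under the inverse of [g]. *)
Definition translate (g : N -> N) (Z : set (I -> N)) := [set a | Z (g \o a)].

Lemma translateK g h : cancel h g -> cancel (translate g) (translate h).
Proof.
move=> hK Z; rewrite predeqE => a; rewrite /translate /=.
suff -> : g \o (h \o a) = a by [].
by apply/funext => i /=.
Qed.

Lemma definableI Z Z' : definable Z -> definable Z' -> definable (Z `&` Z').
Proof.
move=> [B cB dZ] [B' cB' dZ']; exists (B `|` B'); first exact: countable_setU.
by apply: def_overI; [apply: def_over_sub dZ|apply: def_over_sub dZ'];
  move=> x; [left|right].
Qed.

Lemma definableC Z : definable Z -> definable (~` Z).
Proof. by move=> [B cB dZ]; exists B => //; exact: def_overC. Qed.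

Lemma definable_bigI n (Z : nat -> set (I -> N)) :
  (forall k, (k < n)%N -> definable (Z k)) ->
  definable [set a | forall k, (k < n)%N -> Z k a].
Proof.
elim: n => [|n IH] dZ.
  have -> : [set a | forall k, (k < 0)%N -> Z k a] = setT by rewrite predeqE.
  by exists set0 => //; exact: def_overT.
have -> : [set a | forall k, (k < n.+1)%N -> Z k a] =
    [set a | forall k, (k < n)%N -> Z k a] `&` Z n.
  rewrite predeqE => a; split=> [h|[h Zn] k].
    by split=> [k kn|]; apply: h => //; exact: ltnW.
  by rewrite ltnS leq_eqVlt => /orP[/eqP->|/h].
by apply: definableI; [apply: IH => k kn; apply: dZ; exact: ltnW|exact: dZ].
Qed.

Lemma definable_translate g Z :
  Gamma g -> definable Z -> definable (translate g Z).
Proof.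
move=> Gg [B cB [phi ->]]; have [h [Gh gK hK]] := Gamma_inv Gg.
exists (h @` B); first exact: card_le_trans (card_image_le _ _) cB.
pose u (b : B) := h (val b).
have -> : translate g [set a | sat phi (with_params a)] =
    [set a | sat phi (sumv a u)].
  rewrite predeqE => a; rewrite /translate /=.
  rewrite -(sat_aut _ (sumv a u) (Gamma_aut Gg)).
  suff -> : g \o sumv a u = @with_params L N I B (g \o a) by [].
  by apply/funext => -[//|b] /=; rewrite /u hK.
by apply: def_over_sat => b; exists (val b) => //; apply: set_mem; exact: valP.
Qed.

Variable F : set_system (I -> N).
Hypotheses (pF : ProperFilter F) (FC : F C).
Hypothesis Finv : forall g Z, Gamma g -> F Z -> F (translate g Z).
Hypothesis Fmax : forall D, ~ F (~` D) -> exists n (g : nat -> N -> N),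
  (forall k, Gamma (g k)) /\
  F [set a | exists2 k, (k < n)%N & translate (g k) D a].

Lemma F_translate g Z : Gamma g -> F (translate g Z) -> F Z.
Proof.
move=> Gg FZ; have [h [Gh gK hK]] := Gamma_inv Gg.
by rewrite -(translateK hK Z); exact: Finv.
Qed.

Definition positive D := definable D /\ ~ F (~` D).

Lemma positiveT : positive setT.
Proof.
split; first by exists set0 => //; exact: def_overT.
by rewrite setCT => /filter_ex[].
Qed.

Lemma positive_class D : positive D -> exists2 a, C a & D a.
Proof.
move=> [_ pD]; apply: contrapT => nD; apply: pD.
by apply: filterS FC => a Ca Da; apply: nD; exists a.
Qed.

(** Sets with complement in [F] form an ideal: if all the pieces of [D] belonged to it, so would
    [D]. *)
Lemma positive_pigeonhole D n Z : positive D ->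
  (forall k, (k < n)%N -> definable (Z k)) ->
  F [set a | exists2 k, (k < n)%N & Z k a] ->
  exists2 k, (k < n)%N & positive (D `&` Z k).
Proof.
move=> [dD pD] dZ FZ; apply: contrapT => nk; apply: pD.
have : F [set a | forall k, (k < n)%N -> (~` (D `&` Z k)) a].
  apply: filter_below => k kn; apply: contrapT => nF; apply: nk; exists k => //.
  by split=> //; apply: definableI => //; exact: dZ.
move=> /(filterI FZ); apply: filterS => a [[k kn Zka] h] Da.
exact: (h k kn).
Qed.

Lemma positive_translate g D :
  Gamma g -> positive D -> positive (translate g D).
Proof.
move=> Gg [dD pD]; split; first exact: definable_translate.
by move=> FD; apply: pD; exact: (F_translate Gg).
Qed.

Lemma positive_transitive D D' : positive D -> positive D' ->
  exists2 g, Gamma g & positive (D' `&` translate g D).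
Proof.
move=> [dD pD] pD'; have [n [g [Gg FD]]] := Fmax pD.
have [|k _ pk] := positive_pigeonhole pD' _ FD.
  by move=> k _; exact: (definable_translate (Gg k) dD).
by exists (g k).
Qed.

(** An ultrafilter above [F] contains [C], so by thickness it contains the neighbourhood of some
    [c'] in [C]. Were the neighbourhood of [c] null, its translate by an element of [Gamma] taking
    [c'] to [c] would be null too, a contradiction. *)
Lemma thick_positive theta c : thick C theta -> C c ->
  positive [set x | sat theta (sumv c x)].
Proof.
move=> tth Cc; split.
  exists (range c); first exact: countable_range.
  by apply: def_over_satr => i; exists i.
move=> Fc; have [V [uV FV]] := ultraFilterLemma pF.
have VC : V C by exact: FV.
have [c' [Cc' Vc']] := filter_ex (filterI VC (tth V uV VC)).
have [g Gg gc] := Gtrans Cc' Cc.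
have /FV Vn : F (~` [set x | sat theta (sumv c' x)]).
  suff <- : translate g (~` [set x | sat theta (sumv c x)]) =
      ~` [set x | sat theta (sumv c' x)] by exact: Finv.
  rewrite predeqE => x; rewrite /translate /=.
  have -> : sumv c (g \o x) = g \o sumv c' x.
    by rewrite -gc; apply/funext => -[].
  by rewrite sat_aut//; exact: Gamma_aut.
by have [x []] := filter_ex (filterI Vc' Vn).
Qed.

(* The thick neighbourhoods of a point of [C] shrink to a closed subset of [C],
   so by compactness one of them avoids [Z]. *)
Lemma positive_avoid B Z D : small K B -> closed_over B Z -> Z `&` C = set0 ->
  positive D ->
  exists D', [/\ positive D', D' `<=` D & forall x, D' x -> X x -> ~ Z x].
Proof.
move=> sB cZ ZC pD; have [c Cc _] := positive_class pD.
have avoid c' : C c' -> exists2 theta, thick C theta &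
    forall x, sat theta (sumv c' x) -> X x -> ~ Z x.
  move=> Cc'; apply: contrapT => nth.
  pose b theta := [set x | sat theta (sumv c' x)] `&` (X `&` Z).
  have pfb : ProperFilter (filter_from (thick C) b).
    apply: filter_from_proper => [|theta tth].
      apply: filter_from_filter.
        by exists (FNot (FFalse _ _)); exact: thickT.
      move=> t1 t2 h1 h2; exists (FAnd t1 t2); first exact: thickI.
      by move=> x [/= /sat_FAnd[t1x t2x] XZx].
    apply: contrapT => nb; apply: nth; exists theta => // x tx Xx Zx.
    by apply: nb; exists x.
  have sB' : small K (B `|` (A `|` range c')).
    apply: small_setU_countable => //; apply: countable_setU => //.
    exact: countable_range.
  have [x xP] := compactness Kunc Nsat cI sB' pfb.
  have tT := @thickT L N I C.
  have Xx : X x.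
    apply: xP; first by eexists; [exact: tT|move=> y [_ []]].
    by apply: closed_over_sub (type_definable_closed dX) => y Ay; right; left.
  have Zx : Z x.
    apply: xP; first by eexists; [exact: tT|move=> y [_ []]].
    by apply: closed_over_sub cZ => y By; left.
  have Ex : E (c', x).
    apply: (thick_rel Kunc Nsat Nhom cI Einv Eeq Ebd cA dX class_sub) => //.
      exact: class_sub.
    move=> theta tth; apply: (xP [set x | sat theta (sumv c' x)]).
      by exists theta => // y [].
    apply: def_over_closed.
    by apply: def_over_satr => i; right; right; exists i.
  have : (Z `&` C) x.
    split=> //; have [a Xa Ca] := clC; have [_ _ Et] := Eeq.
    have [_ Eac] : X c' /\ E (a, c') by have := Cc'; rewrite Ca.
    by rewrite Ca; split=> //; apply: Et Eac Ex => //; exact: class_sub.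
  by rewrite ZC.
(* To get inside [D], one thick formula [th] is found that serves all the points [g k \o c]. The
   pigeonhole then yields a [k] for which the neighbourhood of [c] meets the translate of [D] in a
   positive set, which is carried back into [D]. *)
have [n [g [Gg FD]]] := Fmax pD.2.
have /choice[theta thetaP] : forall k, exists theta, thick C theta /\
    forall x, sat theta (sumv (g k \o c) x) -> X x -> ~ Z x.
  move=> k; have [theta tth h] := avoid _ (Gamma_class (Gg k) Cc).
  by exists theta.
have [th tth thP] : exists2 th, thick C th & forall k, (k < n)%N ->
    forall v : I + I -> N, sat th v -> sat (theta k) v.
  elim: n {FD} => [|n [th tth IH]].
    by exists (FNot (FFalse _ _)) => //; exact: thickT.
  exists (FAnd th (theta n)); first by apply: thickI => //; exact: (thetaP n).1.
  move=> k; rewrite ltnS leq_eqVlt.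
  move=> /orP[/eqP-> v /sat_FAnd[]//|kn v /sat_FAnd[+ _]].
  exact: IH.
have [|k kn pk] := positive_pigeonhole (thick_positive tth Cc) _ FD.
  by move=> k _; exact: (definable_translate (Gg k) pD.1).
have [h [Gh gK hK]] := Gamma_inv (Gg k).
exists (translate h ([set x | sat th (sumv c x)] `&` translate (g k) D)); split.
- exact: positive_translate.
- by move=> x [_ Dx]; rewrite -(translateK hK D).
- move=> x [thx _]; apply: (thetaP k).2; apply: thP => //.
  rewrite /= in thx; rewrite -(sat_aut _ _ (Gamma_aut (Gg k))) in thx.
  suff -> : sumv (g k \o c) x = g k \o sumv c (h \o x) by [].
  by apply/funext => -[//|i] /=; rewrite hK.
Qed.

(** * Generic points *)

Definition descending (d : nat -> set (I -> N)) :=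
  forall n, positive (d n) /\ d n.+1 `<=` d n.

Definition dense_family (Q : set (set (I -> N))) :=
  forall D, positive D -> exists D', [/\ positive D', D' `<=` D & Q D'].

(* [P] holds of all points of [X] in the intersection of a sufficiently generic
   descending sequence of positive sets.  Genericity is a property of the
   sequence rather than of the point, since a realized point also lies in
   definable sets that are not positive. *)
Definition generically (P : (nat -> set (I -> N)) -> (I -> N) -> Prop) :=
  exists2 Q : nat -> set (set (I -> N)), forall n, dense_family (Q n) &
    forall d a, descending d -> (forall n, exists k, Q n (d k)) -> X a ->
      (forall k, d k a) -> P d a.

Lemma descending_sub d m n : descending d -> (m <= n)%N -> d n `<=` d m.
Proof.
move=> dd /subnK <-; elim: (n - m)%N => // k IH.
exact: subset_trans (dd _).2 IH.
Qed.

(** The Baire category argument: step [n] shrinks the current set into [Q n]. Compactness gives a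
    point in the end, since each positive set meets [C] and hence [X]. *)
Lemma generic_exists D P : positive D -> generically P ->
  exists d a, [/\ descending d, d 0%N = D, X a, forall k, d k a & P d a].
Proof.
move=> pD [Q Qd QP].
pose T := (nat * {D | positive D})%type.
pose R (p q : T) :=
  [/\ q.1 = p.1.+1, sval q.2 `<=` sval p.2 & Q p.1 (sval q.2)].
have next p : {q | R p q}.
  apply: cid; case: p => n [D0 pD0].
  have [D' [pD' D'D QD']] := Qd n _ pD0.
  by exists (n.+1, exist _ D' pD').
have [f [f0 fS]] := dependent_choice next (0%N, exist _ D pD).
have fn n : (f n).1 = n.
  by elim: n => [|n IH]; [rewrite f0|have [-> _ _] := fS n; rewrite IH].
pose d n := sval (f n).2.
have dd : descending d.
  by move=> n; split; [exact: svalP (f n).2|have [] := fS n].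
have dQ n : Q n (d n.+1) by have [_ _] := fS n; rewrite fn.
have /choice[B BP] : forall n, exists B, countable B /\ def_over B (d n).
  by move=> n; have [[[B cB dB] _] _] := dd n; exists B.
have pfb : ProperFilter (filter_from setT (fun n => d n `&` X)).
  apply: filter_from_proper => [|n _].
    apply: filter_fromT_filter; first by exists 0%N.
    move=> m n; exists (maxn m n) => x [dx Xx]; split; split=> //;
      by apply: descending_sub dx => //; rewrite ?leq_maxl ?leq_maxr.
  have [a Ca da] := positive_class (dd n).1.
  by exists a; split=> //; exact: class_sub.
have sB : small K (A `|` \bigcup_n B n).
  apply: countable_small => //; apply: countable_setU => //.
  by apply: bigcup_countable => // n _; exact: (BP n).1.
have [a aP] := compactness Kunc Nsat cI sB pfb.
have Xa : X a.
  apply: aP; first by exists 0%N => // x [].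
  by apply: closed_over_sub (type_definable_closed dX) => x; left.
have da k : d k a.
  apply: aP; first by exists k => // x [].
  apply: closed_over_sub (def_over_closed (BP k).2) => x Bx.
  by right; exists k.
exists d, a; split=> //; first by rewrite /d f0.
by apply: QP => // n; exists n.+1.
Qed.

Lemma generically_mono P P' : (forall d a, descending d -> P d a -> P' d a) ->
  generically P -> generically P'.
Proof.
move=> PP' [Q Qd QP]; exists Q => // d a dd Qda Xa da.
by apply: PP' => //; exact: QP.
Qed.

(** A pairing of [nat] merges the countably many sequences of dense families into one; numbers that
    code no pair impose nothing. *)
Lemma generically_forall
    (P : nat -> (nat -> set (I -> N)) -> (I -> N) -> Prop) :
  (forall n, generically (P n)) -> generically (fun d a => forall n, P n d a).
Proof.
move=> gP; have /choice[Q QP] : forall n, exists Q : nat -> set (set (I -> N)),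
    (forall k, dense_family (Q k)) /\
    forall d a, descending d -> (forall k, exists j, Q k (d j)) -> X a ->
      (forall k, d k a) -> P n d a.
  by move=> n; have [Q Qd QP] := gP n; exists Q.
exists (fun m => if unpickle m is Some nk then Q nk.1 nk.2 else setT) => [m|].
  case: unpickle => [nk|]; first exact: (QP nk.1).1.
  by move=> D pD; exists D; split.
move=> d a dd Qda Xa da n; apply: (QP n).2 => // k.
by have [j] := Qda (pickle (n, k)); rewrite pickleK; exists j.
Qed.

Lemma generically_and P P' : generically P -> generically P' ->
  generically (fun d a => P d a /\ P' d a).
Proof.
move=> gP gP'.
have h := @generically_forall (fun n => if n is 0%N then P else P').
 apply: generically_mono (h _); last by case.
by move=> d a _ hda; split; [exact: (hda 0%N)|exact: (hda 1%N)].
Qed.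

Lemma generically_dense Q : dense_family Q ->
  generically (fun d _ => exists k, Q (d k)).
Proof. by move=> Qd; exists (fun=> Q) => // d a _ /(_ 0%N). Qed.

Lemma generically_translate P g h : Gamma g -> Gamma h -> cancel g h ->
  cancel h g -> generically P ->
  generically (fun d a => P (translate h \o d) (g \o a)).
Proof.
move=> Gg Gh gK hK [Q Qd QP].
exists (fun n => [set D | Q n (translate h D)]) => [n D pD|].
  have [D' [pD' D'D QD']] := Qd n _ (positive_translate Gh pD).
  exists (translate g D'); split; first exact: positive_translate.
  - by move=> a /D'D; rewrite -{2}(translateK gK D).
  - by rewrite /= (translateK hK).
move=> d a dd Qda Xa da; apply: QP => //.
- move=> n; split; first by apply: positive_translate => //; exact: (dd n).1.
  by move=> b; exact: (dd n).2.
- exact: (Gamma_rel Gg Xa).1.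
- move=> k; have := da k; rewrite -{1}(translateK gK (d k)); exact.
Qed.

(* The property of Baire: [O] plays the role of the open set to which [Z] is
   equal up to a meager set. *)
Definition baire (Z : set (I -> N)) := exists2 O : set (set (I -> N)),
  (forall D D', O D -> D' `<=` D -> O D') &
  generically (fun d a => Z a <-> exists k, O (d k)).

Lemma baire_definable Z : definable Z -> baire Z.
Proof.
move=> dZ; exists [set D | D `<=` Z] => [D D' DZ D'D|].
  exact: subset_trans DZ.
pose Q := [set D | D `<=` Z \/ D `<=` ~` Z].
have Qd : dense_family Q.
  move=> D [dD pD]; have [pDZ|npDZ] := pselect (positive (D `&` Z)).
    exists (D `&` Z).
    by split; [exact: pDZ|exact: subIsetl|left; exact: subIsetr].
  (* When the part of [D] inside [Z] is null, the part outside is positive, as otherwise [D] would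
     be null. *)
  exists (D `&` ~` Z); split; [|exact: subIsetl|right; exact: subIsetr].
  split; first by apply: definableI => //; exact: definableC.
  move=> F1; apply: npDZ; split; first exact: definableI.
  move=> F2; apply: pD; apply: filterS (filterI F1 F2) => x [n1 n2] Dx.
  by apply: n1; split=> // Zx; apply: n2.
exists (fun=> Q) => // d a dd /(_ 0%N)[k [dkZ|dkZ]] Xa da; split.
- by exists k.
- by move=> _; exact/dkZ/da.
- by have := dkZ _ (da k).
- by move=> [j djZ]; exact: djZ (da j).
Qed.

Lemma baire_generically Z Z' : generically (fun _ a => Z a <-> Z' a) ->
  baire Z -> baire Z'.
Proof.
move=> ZZ' [W Wd ZW]; exists W => //.
by apply: generically_mono (generically_and ZZ' ZW) => d a _ [<- ->].
Qed.

(** The exterior of the open set coded by [O], as in forcing the negation. *)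
Definition null_part (O : set (set (I -> N))) : set (set (I -> N)) :=
  [set D | forall D', positive D' -> D' `<=` D -> ~ O D'].

Lemma dense_null_part O : dense_family (O `|` null_part O).
Proof.
move=> D pD; have [nD|nD] := pselect (null_part O D).
  by exists D; split=> //; right.
 apply: contrapT => nn; apply: nD => D' pD' D'D OD'; apply: nn.
by exists D'; split=> //; left.
Qed.

Lemma baireC Z : baire Z -> baire (~` Z).
Proof.
case=> O Od OZ; exists (null_part O).
  move=> D D' nD D'D D'' pD'' D''D'.
  by apply: nD => //; exact: subset_trans D'D.
have gO := generically_and OZ (generically_dense (@dense_null_part O)).
apply: generically_mono gO.
move=> d a dd [ZO [k Ok]] /=; split=> [nZ|[j nOj] /ZO[i Oi]].
  by exists k; case: Ok => // Ok; case: nZ; apply/ZO; exists k.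
apply: (nOj (d (maxn i j))) => //; first exact: (dd _).1.
  by apply: descending_sub => //; exact: leq_maxr.
by apply: Od Oi _; apply: descending_sub => //; exact: leq_maxl.
Qed.

Lemma baire_bigcup (Z : nat -> set (I -> N)) :
  (forall n, baire (Z n)) -> baire (\bigcup_n Z n).
Proof.
move=> bZ; have /choice[W WP] : forall n, exists O : set (set (I -> N)),
    (forall D D', O D -> D' `<=` D -> O D') /\
    generically (fun d a => Z n a <-> exists k, O (d k)).
  by move=> n; have [W Wd ZW] := bZ n; exists W.
exists (\bigcup_n W n).
  by move=> D D' [n _ WD] D'D; exists n => //; exact: (WP n).1 WD D'D.
apply: generically_mono (generically_forall (fun n => (WP n).2)) => d a dd h.
split=> [[n _ /h[k Ok]]|[k [n _ Ok]]]; first by exists k, n.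
by exists n => //; apply/h; exists k.
Qed.

(* Topological zero-one law: [Gamma] acts transitively on positive sets. *)
Lemma zero_one Z : baire Z ->
  generically (fun _ a => forall g, Gamma g -> Z a <-> Z (g \o a)) ->
  generically (fun _ a => Z a) \/ generically (fun _ a => ~ Z a).
Proof.
case=> O Od OZ Zinv.
have gO := generically_and OZ (generically_dense (@dense_null_part O)).
have [[D [pD OD]]|nO] := pselect (exists D, positive D /\ O D); last first.
  right; have gT : generically (fun d _ => descending d).
    by exists (fun=> setT) => // _ D pD; exists D; split.
  apply: generically_mono (generically_and OZ gT) => d a _ [ZO dd] /ZO[k Ok].
  by apply: nO; exists (d k); split=> //; exact: (dd k).1.
left; have [Odense|] := pselect (dense_family O).
  apply: generically_mono (generically_and OZ (generically_dense Odense)).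
  by move=> d a _ [-> ].
(* Let no positive subset of [D'] be in [O]. A generic point of [D'] that [g] moves into [D] has its
   image in [Z], so by invariance it lies in [Z] itself, and this puts a positive subset of [D']
   into [O]. *)
move=> nOd; exfalso; apply: nOd => D' pD'; apply: contrapT => nD'.
have [g Gg pDD'] := positive_transitive pD pD'.
have [h [Gh gK hK]] := Gamma_inv Gg.
have gen := generically_and OZ (generically_and Zinv
  (generically_translate Gg Gh gK hK OZ)).
have [d [a [dd d0 Xa da [ZO [Zg ZgO]]]]] := generic_exists pDD' gen.
have /ZO[k Ok] : Z a.
  apply/(Zg g Gg)/ZgO; exists 0%N; rewrite /= d0; apply: Od OD _ => x [_].
  by rewrite -{2}(translateK hK D).
apply: nD'; exists (d k); split=> //; first exact: (dd k).1.
by apply: subset_trans (descending_sub dd (leq0n k)) _; rewrite d0 => x [].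
Qed.

(** * A generic class is strongly closed *)

Section NormalForm.
Variable U : nat -> set ((I -> N) * (I -> N)).
Hypothesis NF : normal_form X E U.

Lemma normal_form_refl n a : X a -> U n (a, a).
Proof.
move=> Xa; have [_ _ U0 _ UU] := NF.
by elim: n => [|n IH]; [exact: U0|exact: (UU n a a a)].
Qed.

Lemma normal_form_le m n a b :
  (m <= n)%N -> X a -> X b -> U m (a, b) -> U n (a, b).
Proof.
move=> /subnK <- Xa Xb Uab; have [_ _ _ _ UU] := NF.
elim: (n - m)%N => [//|k IH].
by apply: (UU _ _ _ b) => //; exact: normal_form_refl.
Qed.

Lemma normal_form_aut g n a b :
  automorphism g -> U n (a, b) -> U n (g \o a, g \o b).
Proof.
move=> ag Uab; have [/(_ n)[S US] _ _ _ _] := NF.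
have : flatten_rel (U n) (sumv a b) by [].
have : flatten_rel (U n) (g \o sumv a b) = U n (g \o a, g \o b) by [].
rewrite US /= => <- h phi /h; rewrite -(sat_aut _ _ ag).
suff -> : g \o with_params (sumv a b) =
  @with_params L N _ set0 (g \o sumv a b) by [].
by apply/funext => -[//|[b0 b0P]]; have := set_mem b0P.
Qed.

Lemma normal_form_fiber n a : closed_over (range a) [set x | U n (a, x)].
Proof.
have [/(_ n) dU _ _ _ _] := NF.
have := @type_definable_fiber _ _ _ _ _ _ a dU.
by rewrite set0U.
Qed.

Lemma normal_form_rel n a b : U n (a, b) -> E (a, b).
Proof. by have [_ -> _ _ _] := NF => Uab; exists n. Qed.

(* If [E (a0, -)] is generic, then some [U n (a0, -)] is not negligible on some
   positive set [D].  The union of finitely many translates of [D] is in [F], and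
   the translates of [U n (a0, -)] lie in a single [U m (a0, -)]. *)
Lemma conull_neighbourhood a0 : X a0 -> generically (fun _ b => E (a0, b)) ->
  exists m, forall psi, definable psi ->
    (forall x, X x -> U m (a0, x) -> psi x) -> F psi.
Proof.
move=> Xa0 gE; have [_ EU _ Usym UU] := NF.
have [D [n [pD DU]]] : exists D n, positive D /\ forall D', positive D' ->
    D' `<=` D -> exists x, [/\ D' x, X x & U n (a0, x)].
  (* Otherwise every [U n (a0, -)] is nowhere dense, and a generic point avoids them all although it
     is equivalent to [a0]. *)
  apply: contrapT => nDn.
  pose Q n := [set D' | forall x, D' x -> X x -> ~ U n (a0, x)].
  have Qd n : dense_family (Q n).
    move=> D pD; apply: contrapT => nD'.
    apply: nDn; exists D, n; split=> // D' pD' D'D.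
    apply: contrapT => nx; apply: nD'; exists D'; split=> // x D'x Xx Ux.
    by apply: nx; exists x.
  have gQ := generically_forall (fun n => generically_dense (Qd n)).
  have [d [b [_ _ Xb db [Eb Qb]]]] :=
    generic_exists positiveT (generically_and gE gQ).
  have [n _ Un] : (\bigcup_n U n) (a0, b) by rewrite -EU.
  by have [k] := Qb n; apply; first exact: db.
have Dpsi psi : definable psi -> (forall x, X x -> U n (a0, x) -> psi x) ->
    F (~` (D `&` ~` psi)).
  move=> dpsi Upsi; apply: contrapT => nF.
  have [|x [[_ nx] Xx Ux]] := DU (D `&` ~` psi) _ (@subIsetl _ _ _).
    by split=> //; apply: definableI; [exact: pD.1|exact: definableC].
  by apply: nx; exact: Upsi.
have [r [g [Gg FD]]] := Fmax pD.2.
have /choice[h hP] : forall k, exists h,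
    [/\ Gamma h, cancel (g k) h & cancel h (g k)].
  by move=> k; exact: Gamma_inv.
have Gh k : Gamma (h k) by have [] := hP k.
have /choice[l lP] : forall k, exists l, U l (a0, h k \o a0).
  move=> k; have [_] := Gamma_rel (Gh k) Xa0.
  by rewrite EU => -[l _ Ul]; exists l.
(* A common bound for [n] and the levels at which [a0] is related to its finitely many images
   [h k \o a0]. *)
pose m := maxn n (\max_(k < r) l k)%N.
have Um k : (k < r)%N -> U m (a0, h k \o a0).
  move=> kr; apply: normal_form_le (lP k) => //; last exact: (Gamma_rel _ _).1.
  rewrite leq_max; apply/orP; right.
  exact: (leq_bigmax (F := fun k : 'I_r => l k) (Ordinal kr)).
(* [U m] relates [a0] to [h k \o a0], and the latter to [h k \o x]; composing the two costs one
   level. *)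
exists m.+1 => psi dpsi Upsi.
(* A neighbourhood of [U n (a0, -)] that every [h k] maps into [psi]. Up to a null set [D] lies
   inside [psi0], so [F]-almost every point, being moved into [D] by some [g k] and back by [h k],
   lies in [psi]. *)
pose psi0 := [set a | forall k, (k < r)%N -> translate (h k) psi a].
have dpsi0 : definable psi0.
  by apply: definable_bigI => k _; exact: (definable_translate (Gh k) dpsi).
have Upsi0 x : X x -> U n (a0, x) -> psi0 x.
  move=> Xx Ux k kr; have Xhx := (Gamma_rel (Gh k) Xx).1.
  have Xha := (Gamma_rel (Gh k) Xa0).1.
  apply: Upsi => //; apply: UU (Um k kr) _ => //.
  apply: normal_form_le (normal_form_aut (Gamma_aut (Gh k)) Ux) => //.
  exact: leq_maxl.
have : F [set a | forall k, (k < r)%N ->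
    translate (g k) (~` (D `&` ~` psi0)) a].
  by apply: filter_below => k _; apply: (Finv (Gg k)); exact: Dpsi.
move=> /(filterI FD); apply: filterS => a [[k kr Da] /(_ k kr) nDa].
have /(_ k kr) : psi0 (g k \o a) by apply: contrapT => n0; apply: nDa.
rewrite /translate /=; suff -> : h k \o (g k \o a) = a by [].
by have [_ gK _] := hP k; apply/funext => i /=.
Qed.

Lemma generic_class_strongly_closed a0 : X a0 ->
  generically (fun _ b => E (a0, b)) -> strongly_closed C E U.
Proof.
move=> Xa0 gE; have [_ EU _ Usym UU] := NF; have [_ Es Et] := Eeq.
have [m Fm] := conull_neighbourhood Xa0 gE.
have FX : F X by apply: filterS FC; exact: class_sub.
have [c [Cc Xc]] : exists c, C c /\ X c.
  have [c Cc _] := positive_class positiveT.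
  by exists c; split=> //; exact: class_sub.
have smallB (c' : I -> N) : small K (A `|` (range c' `|` range a0)).
  apply: (countable_small Kunc); apply: countable_setU => //.
  by apply: countable_setU; exact: countable_range.
have Xcl (c' : I -> N) : closed_over (A `|` (range c' `|` range a0)) X.
  by apply: closed_over_sub (type_definable_closed dX) => y; left.
(* Thick neighbourhoods of [c] are positive and so meet every member of [F]. By compactness some [x]
   is equivalent to [c] and lies in all neighbourhoods of [U m (a0, -)], hence is equivalent to
   [a0]. *)
have Ca0 : C a0.
  pose D0 := [set p : formula L (I + I) * set (I -> N) | thick C p.1 /\ F p.2].
  pose b (p : formula L (I + I) * set (I -> N)) :=
    [set x | sat p.1 (sumv c x)] `&` p.2.
  have tT := @thickT L N I C.
  have pfb : ProperFilter (filter_from D0 b).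
    apply: filter_from_proper => [|[th W] [/= tth FW]].
      apply: filter_from_filter.
        by exists (FNot (FFalse _ _), setT); split=> //; exact: filterT.
      move=> [t1 W1] [t2 W2] [/= h1 F1] [/= h2 F2].
      exists (FAnd t1 t2, W1 `&` W2).
        by split; [exact: thickI|exact: filterI].
      by move=> x [/= /sat_FAnd[t1x t2x] [W1x W2x]].
    apply: contrapT => nb; apply: (thick_positive tth Cc).2.
    by apply: filterS FW => x Wx thx; apply: nb; exists x.
  have [x xP] := compactness Kunc Nsat cI (smallB c) pfb.
  have FxP Z : F Z -> closed_over (A `|` (range c `|` range a0)) Z -> Z x.
    by move=> FZ; apply: xP; exists (FNot (FFalse _ _), Z) => [|y []].
  have Xx : X x by exact: FxP.
  have Ecx : E (c, x).
    apply: (thick_rel Kunc Nsat Nhom cI Einv Eeq Ebd cA dX class_sub) => //.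
    move=> th tth.
    apply: (xP [set x | sat th (sumv c x)]).
      by exists (th, setT) => [|y []//]; split=> //; exact: filterT.
    apply: def_over_closed.
    by apply: def_over_satr => i; right; left; exists i.
  have Eax : E (a0, x).
    apply: (@normal_form_rel m); apply: normal_form_fiber => D dD UD.
    apply: FxP.
      apply: Fm => [|y _]; last exact: UD.
      by exists (range a0) => //; exact: countable_range.
    by apply: closed_over_sub (def_over_closed dD) => y; right; right.
  have [a Xa Ca] := clC.
  have [_ Eac] : X c /\ E (a, c) by have := Cc; rewrite Ca.
  rewrite Ca; split=> //; have Ex := Et _ _ _ Xa Xc Xx Eac Ecx.
  exact: Et _ _ _ Xa Xx Xa0 Ex (Es _ _ Xa0 Xx Eax).
(* With [g] taking [a0] to [c'], the neighbourhoods of [U m (a0, -)] and of [U m (c', -)] are all in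
   [F], so the two sets have a common point [x]. *)
have Um c' : C c' -> U m.+1 (a0, c').
  move=> Cc'; have Xc' : X c' by exact: class_sub.
  have [g Gg gE'] := Gtrans Ca0 Cc'.
  have [x xP] := compactness Kunc Nsat cI (smallB c') pF.
  have Xx : X x by exact: xP.
  have Uax : U m (a0, x).
    apply: normal_form_fiber => D dD UD; apply: xP.
      apply: Fm => [|y _]; last exact: UD.
      by exists (range a0) => //; exact: countable_range.
    by apply: closed_over_sub (def_over_closed dD) => y; right; right.
  have Ucx : U m (c', x).
    apply: normal_form_fiber => D dD UD; apply: xP.
      apply: (F_translate Gg); apply: Fm.
        apply: definable_translate => //; exists (range c') => //.
        exact: countable_range.
      move=> y Xy Uy; apply: UD; rewrite /= -gE'.
      by apply: normal_form_aut Uy; exact: Gamma_aut.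
    by apply: closed_over_sub (def_over_closed dD) => y; right; left.
  by apply: UU Uax _ => //; exact: Usym.
(* Two points of [C] are joined through [a0], one level above [m.+1]. *)
exists m.+2; apply/seteqP; split=> -[a b] [h [Ca Cb]]; split=> //=.
  apply: UU (Usym _ _ _ (Um a Ca)) (Um b Cb) => //; exact: class_sub.
exact: normal_form_rel h.
Qed.

End NormalForm.

(** The complement of each pseudo open set in the intersection misses [C], so by [positive_avoid]
    the positive sets that avoid it within [X] are dense. *)
Lemma generically_Gdelta Y : pseudo_Gdelta K Y -> C `<=` Y ->
  generically (fun _ a => Y a).
Proof.
case=> W Wo -> CW.
have Wd n : dense_family [set D | forall x, D x -> X x -> W n x].
  move=> D pD; have [B sB dB] := Wo n.
  have [|D' [pD' D'D D'W]] := positive_avoid sB (type_definable_closed dB) _ pD.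
    by apply/seteqP; split=> // x [nWx /CW/(_ n Logic.I)].
  by exists D'; split=> // x D'x Xx; apply: contrapT; exact: D'W.
have [Q Qd QP] := generically_forall (fun n => generically_dense (Wd n)).
exists Q => // d a dd Qda Xa da n _.
by have [k] := QP d a dd Qda Xa da n; apply.
Qed.

(** * Borel reductions *)

Section Smooth.
Variables (Y : set (I -> N)) (M : set N).
Hypotheses (CY : C `<=` Y) (YX : Y `<=` X) (GdY : pseudo_Gdelta K Y).
Hypotheses (satY : class_saturated X E Y) (cL : countable_language L).
Hypotheses (elM : elementary_substructure M) (cM : countable M) (AM : A `<=` M).

(** An open set is a union of finite intersections of basic clopen sets, and a conjunction expresses
    each of them. *)
Lemma open_tp (W : set (@stone_space L N I M)) a : open W -> W (tp M a) ->
  exists phi : formula L (I + M), sat phi (with_params a) /\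
    forall b, sat phi (with_params b) -> W (tp M b).
Proof.
case=> J Jsub <- [Z JZ Za].
have [/= S Ssub SZ] := Jsub _ JZ.
suff [phi phiE] : exists phi : formula L (I + M), forall b,
    sat phi (with_params b) <-> Z (tp M b).
  by exists phi; rewrite phiE; split=> // b /phiE Zb; exists Z.
have seq_conj (s : seq (set (@stone_space L N I M))) :
    (forall W, W \in s -> exists phi, W = @basic_clopen L N I M phi) ->
    exists phi : formula L (I + M), forall b,
      sat phi (with_params b) <-> (\big[setI/setT]_(W <- s) W) (tp M b).
  elim: s => [_|W' s IH Ws].
    by exists (FNot (FFalse _ _)) => b; rewrite big_nil; split=> //= _ [].
  have [|psi psiE] := IH.
    by move=> V Vs; exact: (Ws V (mem_behead (s := W' :: s) Vs)).
  have [phi Wphi] := Ws W' (mem_head _ _).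
  by exists (FAnd phi psi) => b; rewrite sat_FAnd psiE big_cons Wphi.
rewrite -SZ bigcap_fset; apply: seq_conj => W' W'S.
by have := Ssub _ W'S; rewrite inE => -[phi _ <-]; exists phi.
Qed.

(** Over a countable language and model an open set pulls back to a countable union of definable
    sets, indexed by codes of formulas. *)
Lemma baire_open (W : set (@stone_space L N I M)) : open W ->
  baire [set a | W (tp M a)].
Proof.
move=> oW.
have cIM : countable [set: I + M].
  have -> : [set: I + M] = inl @` [set: I] `|` inr @` [set: M].
    by apply/seteqP; split=> // -[i|i] _; [left|right]; exists i.
  have cMT : countable [set: M] by rewrite (eq_countable (card_setT _)).
  by apply: countable_setU; exact: countable_range.
have /countable_injP[c cinj] := countable_formula cL cIM.
pose Z n := [set a | exists phi : formula L (I + M), [/\ c phi = n,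
  forall b, sat phi (with_params b) -> W (tp M b) & sat phi (with_params a)]].
have -> : [set a | W (tp M a)] = \bigcup_n Z n.
  rewrite predeqE => a; split=> [/(open_tp oW)[phi [phia phiW]]|].
    by exists (c phi) => //; exists phi.
  by case=> n _ [phi [_ phiW phia]]; exact: phiW.
apply: baire_bigcup => n; apply: baire_definable.
have [[phi [cphi phiW]]|nphi] := pselect (exists phi : formula L (I + M),
    c phi = n /\ forall b, sat phi (with_params b) -> W (tp M b)).
  have -> : Z n = [set a | sat phi (with_params a)].
    rewrite predeqE => a; split=> [[psi [cpsi _]]|phia]; last by exists phi.
    by have -> : psi = phi by apply: cinj; rewrite ?inE// cpsi.
  by exists M => //; exists phi.
have -> : Z n = ~` setT.
  rewrite setCT; apply/seteqP; split=> // a [psi [cpsi psiW _]].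
  by apply: nphi; exists psi.
by apply: definableC; exact: positiveT.1.
Qed.

(** Complements and open sets are relative to [types_of M Y]. Generic points have their types there,
    so this restriction does not affect the property of Baire. *)
Lemma baire_borel (W : set (@stone_space L N I M)) :
  <<s types_of M Y, [set types_of M Y `&` O | O in [set O | open O]] >> W ->
  baire [set a | W (tp M a)].
Proof.
have gY : generically (fun _ a => types_of M Y (tp M a)).
  by apply: generically_mono (generically_Gdelta GdY CY) => d a _ Ya; exists a.
have gI (Z : set (I -> N)) :
    baire Z -> baire [set a | types_of M Y (tp M a) /\ Z a].
  apply: baire_generically; apply: generically_mono gY => d a _ Ya.
  by split=> [|[]].
move=> sW; apply: (sW [set W | baire [set a | W (tp M a)]]); split.
  split.
  - rewrite /= [X in baire X](_ : _ = ~` setT); last by rewrite setCT.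
    by apply: baire_definable; apply: definableC; exact: positiveT.1.
  - by move=> W' bW'; apply: gI; exact: baireC.
  - by move=> W' bW'; exact: baire_bigcup bW'.
by move=> _ [W' oW' <-]; apply: gI; exact: baire_open.
Qed.

Lemma generic_class (f : @stone_space L N I M -> cantor_space) :
  borel_on (types_of M Y) f ->
  (forall p q, types_of M Y p -> types_of M Y q ->
     (type_rel E p q <-> f p = f q)) ->
  exists2 a0, X a0 & generically (fun _ b => E (a0, b)).
Proof.
move=> bf fE; have gY := generically_Gdelta GdY CY.
have [_ Es Et] := Eeq.
have XM : closed_over M X := closed_over_sub AM (type_definable_closed dX).
have Yinv g a : Gamma g -> Y a -> Y (g \o a).
  move=> Gg Ya; have [D DX YE] := satY.
  move: Ya; rewrite YE => -[Z DZ Za]; exists Z => //.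
  by rewrite -(Gpres Gg (DX _ DZ)); exists a.
(* [type_rel] provides equivalent realizations [a'] and [b'] of the two types; they are equivalent
   to [a] and [b] by [model_type_rel]. *)
have f_rel a b : Y a -> Y b -> f (tp M a) = f (tp M b) -> E (a, b).
  move=> Ya Yb /fE[||a' [b' [ta tb Eab]]]; [by exists a|by exists b|].
  have mtr := model_type_rel Kunc Nsat Nhom cI Einv Eeq Ebd elM cM XM.
  have Xa := YX Ya; have Xb := YX Yb.
  have Eaa' := mtr _ _ Xa (esym ta); have Ebb' := mtr _ _ Xb (esym tb).
  have XtX c c' : X c -> tp M c' = tp M c -> X c'.
    move=> Xc tc; apply: XM => D dD XD.
    by apply/(tp_def_over tc dD); exact: XD.
  have Xa' := XtX _ _ Xa ta; have Xb' := XtX _ _ Xb tb.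
  exact: Et (Et _ _ _ Xa Xa' Xb' Eaa' Eab) (Es _ _ Xb Xb' Ebb').
(* By the zero-one law each coordinate of [f] takes a constant value at generic points, so all of
   them have the same image under [f]. *)
pose Z n := [set a | types_of M Y (tp M a) /\ f (tp M a) n].
have bZ n : baire (Z n).
  apply: (@baire_borel (types_of M Y `&` f @^-1` [set x | x n])).
  apply: bf; apply: sub_sigma_algebra.
  have [pc _] :=
    @continuousP _ _ (@proj nat (fun=> bool) n : cantor_space -> bool).
  exact: pc (@proj_continuous _ _ n) _ (discrete_open [set true]).
have Zinv n :
    generically (fun _ a => forall g, Gamma g -> Z n a <-> Z n (g \o a)).
  apply: generically_mono gY => d a _ Ya g Gg.
  have Yga := Yinv _ _ Gg Ya.
  rewrite /Z /=; have <- : f (tp M a) = f (tp M (g \o a)).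
    apply/fE; [by exists a|by exists (g \o a)|].
    by exists a, (g \o a); split=> //; exact: (Gamma_rel Gg (YX Ya)).2.
  by split=> -[_ fa]; split=> //; [exists (g \o a)|exists a].
have /choice[z zP] : forall n, exists z : bool,
    generically (fun _ a => f (tp M a) n = z).
  move=> n; have [gZ|gZ] := zero_one (bZ n) (Zinv n).
    by exists true; apply: generically_mono gZ => d a _ [].
  exists false.
  apply: generically_mono (generically_and gY gZ) => d a _ [Ya nZ].
  by apply/negbTE/negP => fa; apply: nZ; split=> //; exists a.
have gz := generically_and gY (generically_forall zP).
have [d [a0 [_ _ Xa0 _ [Ya0 fa0]]]] := generic_exists positiveT gz.
exists a0 => //; apply: generically_mono gz => d' b _ [Yb fb].
by apply: f_rel => //; apply/funext => n; rewrite fa0 fb.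
Qed.

End Smooth.

End Dynamics.

Theorem theorem3p17 (L : language) (T : theory L) (K : Type) (Mon : structure L)
    (A : set Mon) (alpha : Type)
    (X C Y : set (alpha -> Mon))
    (E : set ((alpha -> Mon) * (alpha -> Mon)))
    (U : nat -> set ((alpha -> Mon) * (alpha -> Mon)))
    (Gamma : set (Mon -> Mon)) :
  countable_language L -> complete_theory T ->
  models Mon T -> monster K Mon ->
  countable A -> countable [set: alpha] ->
  type_definable A X ->
  invariant_Fsigma_equivalence K X E -> normal_form X E U ->
  bounded_on K X E ->
  is_class X E C -> ~ strongly_closed C E U ->
  C `<=` Y -> Y `<=` X -> pseudo_Gdelta K Y -> class_saturated X E Y ->
  automorphism_subgroup Gamma -> transitive_on C Gamma ->
  preserves_classes X E Gamma ->
  ~ smooth A E Y.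
Proof.
move=> cL _ _ [Kunc Nsat Nhom] cA cI dX [Einv _ Eeq] NF Ebd clC nsc CY YX GdY
  satY Gsub Gtrans Gpres [M [elM cM AM [f bf fE]]].
apply: nsc.
(* The action of [Gamma] on tuples, since [maximal_invariant_filter] speaks of transformations of
   the underlying set. *)
pose G := [set t : (alpha -> Mon) -> alpha -> Mon |
  exists2 g, Gamma g & t = (fun a => g \o a)].
have [_ G1 GM _] := Gsub.
have [||||F [pF FC Finv Fmax]] := @maximal_invariant_filter _ G C.
- have [a Xa ->] := clC; have [Er _ _] := Eeq.
  by exists a; split=> //; exact: Er.
- by exists id.
- by move=> _ _ [g Gg ->] [h Gh ->]; exists (g \o h) => //; exact: GM.
- by move=> _ [g Gg ->] c Cc; exact: (Gamma_class clC Gpres Gg).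
have Finv' g Z : Gamma g -> F Z -> F (translate g Z).
  by move=> Gg; apply: Finv; exists g.
have Fmax' D : ~ F (~` D) -> exists n (g : nat -> Mon -> Mon),
    (forall k, Gamma (g k)) /\
    F [set a | exists2 k, (k < n)%N & translate (g k) D a].
  move=> /Fmax[n [t [Gt Ft]]].
  have /choice[g gP] : forall k, exists g, Gamma g /\ t k = (fun a => g \o a).
    by move=> k; have [g Gg tg] := Gt k; exists g.
  exists n, g; split=> [k|]; first exact: (gP k).1.
  apply: filterS Ft => a [k kn Da]; exists k => //.
  by move: Da; rewrite (gP k).2.
have [a0 Xa0 ga0] := generic_class Kunc Nsat Nhom cI Einv Eeq Ebd cA dX clC Gsub
  Gtrans Gpres pF FC Finv' Fmax' CY YX GdY satY cL elM cM AM bf fE.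
exact: (generic_class_strongly_closed Kunc Nsat Nhom cI Einv Eeq Ebd cA dX clC
  Gsub Gtrans Gpres pF FC Finv' Fmax' NF Xa0 ga0).
Qed.
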